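(* Let $X$ be a real-valued random variable with an absolutely continuous distribution, mean $\mu=\mathbb{E}X$ and finite variance $\sigma_X^2$, and let $X_1,\dots,X_N,Y_1,\dots,Y_N$ be $2N$ independent copies of $X$. Let $\eta\in[0,1)$ be the contamination level and let $\widetilde X_1,\dots,\widetilde X_N,\widetilde Y_1,\dots,\widetilde Y_N$ be any corrupted sample obtained by an adversary changing at most $2\eta N$ of these $2N$ points. Let $\delta\in(0,1)$ be such that $\delta\ge e^{-N}/4$, set $$\varepsilon = 8\eta+12\,\frac{\log(4/\delta)}{N},$$ and define the estimator $$\widehat\mu=\frac1N\sum_{i=1}^N\phi_{\alpha,\beta}(\widetilde X_i),\qquad \alpha=\widetilde Y^*_{\varepsilon N},\quad \beta=\widetilde Y^*_{(1-\varepsilon)N}.$$ Then, with probability at least $1-\delta$, $$|\widehat\mu-\mu|\le 3\,\mathcal{E}(4\varepsilon,X)+2\sigma_X\sqrt{\frac{\log(4/\delta)}{N}}.$$ Moreover, with probability at least $1-4\exp(-\varepsilon N/12)$, $$|\widehat\mu-\mu|\le 10\sqrt{\varepsilon}\,\sigma_X .$$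
   Context: Adversarial contamination: the adversary may look at the whole sample, knows the estimator, and may replace at most $2\eta N$ of the $2N$ points by arbitrary real values. That is, $(\widetilde X_i)_{i\le N},(\widetilde Y_i)_{i\le N}$ are arbitrary random variables on the same probability space (depending arbitrarily on the sample) such that at most $2\eta N$ of the $2N$ points differ from the corresponding original points. Notation. $\overline X=X-\mu$. For $0<p<1$, $Q_p(\overline X)=\sup\{M\in\mathbb{R}:\mathbb{P}(\overline X\ge M)\ge 1-p\}$. For $t>0$ such that $t/2\in(0,1)$, $$\mathcal{E}(t,X)=\max\Big\{\mathbb{E}\big[|\overline X|\,\mathbf 1_{\overline X\le Q_{t/2}(\overline X)}\big],\ \mathbb{E}\big[|\overline X|\,\mathbf 1_{\overline X\ge Q_{1-t/2}(\overline X)}\big]\Big\}.$$ For $\alpha\le\beta$, $\phi_{\alpha,\beta}(x)=\beta$ if $x>\beta$, $\phi_{\alpha,\beta}(x)=x$ if $x\in[\alpha,\beta]$, and $\phi_{\alpha,\beta}(x)=\alpha$ if $x<\alpha$. For $x_1,\dots,x_m\in\mathbb{R}$, $x_1^*\le x_2^*\le\dots\le x_m^*$ denotes the non-decreasing rearrangement. Convention: the parameters are such that the quantities above are well defined, i.e. $\varepsilon<1/2$ (so that $Q_{2\varepsilon}$, $Q_{1-2\varepsilon}$ are defined and $\alpha\le\beta$), and $\varepsilon N$ is an integer. *)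

(* Defs.v *)
From mathcomp Require Export all_boot all_order all_algebra.
From mathcomp Require Export all_classical all_reals all_analysis.

Set Implicit Arguments.
Unset Strict Implicit.
Unset Printing Implicit Defensive.

Import Order.TTheory GRing.Theory Num.Theory.
Import numFieldNormedType.Exports.

Local Open Scope classical_set_scope.
Local Open Scope ring_scope.

Section Law.
Context d (T : measurableType d) (R : realType) (P : probability T R).

Definition absolutely_continuous (X : {RV P >-> R}) : Prop :=
  distribution P X `<< @lebesgue_measure R.

(* Meaningful for 0 < p < 1: otherwise the set may be empty or unbounded above,
   and sup defaults to 0. *)
Definition quantile (Z : T -> R) (p : R) : R :=
  sup [set M : R | ((1 - p)%:E <= P [set w | (M <= Z w)%R])%E].

Definition mean (X : T -> R) : R := fine ('E_P[X])%E.

Definition stddev (X : T -> R) : R := Num.sqrt (fine ('V_P[X])%E).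

Definition centered (X : T -> R) : T -> R := fun w => X w - mean X.

(* The larger of the two tail contributions to the mean absolute deviation, each
   tail having probability t / 2 when X has a continuous law. *)
Definition tail_mean (t : R) (X : T -> R) : \bar R :=
  let Z := centered X in
  let lo := [set w | Z w <= quantile Z (t / 2)] in
  let hi := [set w | quantile Z (1 - t / 2) <= Z w] in
  (maxe 'E_P[fun w => (`|Z w| * \1_lo w)%R]
        'E_P[fun w => (`|Z w| * \1_hi w)%R])%E.

Definition mutually_independent (I : finType) (Z : I -> {RV P >-> R}) : Prop :=
  forall (J : {set I}) (B : I -> set R),
    (forall i, i \in J -> measurable (B i)) ->
    P (\bigcap_(i in [set` J]) (Z i @^-1` B i)) =
    (\prod_(i in J) P (Z i @^-1` B i))%E.

End Law.

Definition identically_distributed (R : realType)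
    d (T : measurableType d) (P : probability T R)
    d' (T' : measurableType d') (P' : probability T' R)
    (X : {RV P >-> R}) (X' : {RV P' >-> R}) : Prop :=
  forall B : set R, measurable B -> distribution P X B = distribution P' X' B.

Section Estimator.
Context (R : realType).

Definition joint_sample (A : Type) (N : nat) (x y : 'I_N -> A)
    (k : 'I_N + 'I_N) : A :=
  match k with inl i => x i | inr i => y i end.

Definition phi (a b x : R) : R :=
  if b < x then b else if x < a then a else x.

(* The rank k is counted from 1. *)
Definition order_stat (m : nat) (x : 'I_m -> R) (k : nat) : R :=
  nth 0 (sort <=%R (codom x)) k.-1.

(* Meant for eps * N a natural number, in which case both truncations are
   exact. *)
Definition trimmed_mean (N : nat) (eps : R) (x y : 'I_N -> R) : R :=
  let alpha := order_stat y (Num.truncn (eps * N%:R)) in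
  let beta := order_stat y (Num.truncn ((1 - eps) * N%:R)) in
  N%:R^-1 * \sum_(i < N) phi alpha beta (x i).

End Estimator.

(* Main.v *)
Require Import Defs.
From mathcomp Require Import all_boot all_order all_algebra.
From mathcomp Require Import all_classical all_reals all_analysis.
From mathcomp Require Import measurable_realfun ring lra zify.

Set Implicit Arguments.
Unset Strict Implicit.
Unset Printing Implicit Defensive.

Import Order.TTheory GRing.Theory Num.Theory.
Import numFieldNormedType.Exports.

Local Open Scope classical_set_scope.
Local Open Scope ring_scope.

(** Write Z = X - mu and L = log (4 / delta), so that eps N = 8 eta N + 12 L and
    the adversary moves at most 2 eta N = eps N / 4 - 3 L points.  Deviations of
    the estimator above mu are controlled by two fixed levels a < b with
    P(Z <= a) = p and P(Z > b) = eps / 4, where p = 2 eps - (4/5) eps^2.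

    The truncation points alpha and beta are order statistics of the corrupted
    second half of the sample.  If more than (5/4) eps N - 3 L of the genuine
    centered Y's lie below a and fewer than (3/4) eps N + 3 L above b, no
    corruption can prevent alpha - mu <= a and beta - mu <= b.  Clipping is
    monotone in its truncation points, and moving one argument changes a value
    clipped to [a, b] by at most b - a; hence muhat - mu is at most the average
    of phi a b (X_i - mu) plus 2 eta (b - a) (corrupted_clipped_sum_le).  Now
    only independent identically distributed variables are left.

    All three random quantities are sums of bounded functions of independent
    copies of X, so Chernoff's method applies (chernoff_iid); it rests on the
    product rule for expectations (expectation_prod_independent).  The two
    counts fail with probability at most exp (- eps N / 12 - 3 L / 2) each
    (few_below_tail, many_above_tail).  With e the mean of phi a b Z, the
    average of the clipped values exceeds e + 2 sigma tau + 2 (b - e) tau^2 with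
    probability at most exp (- N tau^2) (clipped_sum_tail): clipping does not
    increase the variance, and only an upper bound on the variable enters.
    Altogether, off an event of probability at most 2 exp (- N tau^2),
      muhat - mu <= e + 2 sigma tau + 2 (b - e) tau^2 + 2 eta (b - a).

    The right-hand side is then bounded in two ways.  For tau^2 = L / N it is at
    most 3 E(4 eps, X) + 2 sigma tau (deviation_le_tail): the bias e and the
    levels a and b are all controlled by first moments of Z over its two tails
    of mass 2 eps.  For tau^2 = eps / 12 it is at most 10 sqrt eps sigma
    (deviation_le_sigma), by the Cauchy-Schwarz inequality applied to the same
    truncated moments.

    Deviations below mu are deviations above for the variable mu - X, whose
    truncation points are the opposites of beta and alpha.  So the one-sided
    statement (one_sided_bound) is proved for an arbitrary centered function of
    X and used for both signs; the two failure probabilities add up to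
    4 exp (- N tau^2), which is delta, respectively 4 exp (- eps N / 12). *)
(** * Expectation of a product of independent variables *)
Section DecoupledIntegral.
Local Open Scope ereal_scope.
Context d (T : measurableType d) (R : realType) (P : {measure set T -> \bar R}).
Context (m : {measure set R -> \bar R}) (U : T -> R) (Z : T -> R) (c : \bar R).
Hypothesis mU : measurable_fun setT U.
Hypothesis U_ge0 : forall w, (0 <= U w)%R.
Hypothesis mZ : measurable_fun setT Z.
Hypothesis c_ge0 : 0 <= c.
Hypothesis c_fin : c \is a fin_num.
Hypothesis decoupled : forall B, measurable B ->
  \int[P]_w (U w * \1_B (Z w))%:E = c * m B.

Import HBNNSimple.

Let decoupled_simple (h : {nnsfun R >-> R}) :
  \int[P]_w (U w * h (Z w))%:E = c * \int[m]_x (h x)%:E.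
Proof.
have mi y : measurable_fun setT (fun w => \1_(h @^-1` [set y]) (Z w) : R).
  exact: measurableT_comp.
have ge0 y w : 0 <= (y * \1_(h @^-1` [set y]) (Z w))%:E.
  by rewrite EFinM nnfun_muleindic_ge0.
transitivity (\int[P]_w (\sum_(y \in range h)
    (U w * (y * \1_(h @^-1` [set y]) (Z w)))%:E)).
  apply: eq_integral => w _; rewrite fimfunE EFinM -fsumEFin//.
  rewrite ge0_mule_fsumr; last by move=> r; exact: ge0.
  by apply: eq_fsbigr => y _; rewrite -EFinM.
rewrite ge0_integral_fsum//; last 2 first.
- move=> y; apply/measurable_EFinP; apply: measurable_funM => //.
  exact: measurable_funM.
- by move=> y w _; rewrite EFinM mule_ge0// lee_fin.
rewrite (eq_integral (fun x => \sum_(y \in range h)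
    (y * \1_(h @^-1` [set y]) x)%:E)); last first.
  by move=> x _; rewrite fimfunE -fsumEFin.
rewrite ge0_integral_fsum//; last 2 first.
- by move=> y; apply/measurable_EFinP; exact: measurable_funM.
- by move=> y x _; rewrite EFinM nnfun_muleindic_ge0.
rewrite ge0_mule_fsumr; last first.
  by move=> y; apply: integral_ge0 => x _; rewrite EFinM nnfun_muleindic_ge0.
apply: eq_fsbigr => y _.
rewrite (@integralZl_indic_nnsfun _ _ _ m setT measurableT)//=.
rewrite integral_indic//= setIT muleCA -decoupled//.
have [y0|/negP] := boolP (0 <= y)%R; last first.
  move=> /negP; rewrite -ltNge => y0.
  rewrite preimage_nnfun0//.
  under eq_integral do rewrite indic0 /= mulr0 mulr0.
  under [X in _ = _ * X]eq_integral do rewrite indic0 /= mulr0.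
  by rewrite !integral0 mule0.
rewrite -ge0_integralZl//; first last.
- by move=> w _; rewrite lee_fin mulr_ge0.
- by apply/measurable_EFinP; exact: measurable_funM.
by apply: eq_integral => w _; rewrite -EFinM mulrCA.
Qed.

(** The hypothesis says that the measure with density U, pushed forward by Z, is
    c times m; it passes to simple functions by linearity and to nonnegative
    functions by monotone convergence. *)
Lemma decoupled_integral (f : R -> R) : measurable_fun setT f ->
    (forall x, (0 <= f x)%R) ->
  \int[P]_w (U w * f (Z w))%:E = c * \int[m]_x (f x)%:E.
Proof.
move=> mf f0.
have mEf : measurable_fun setT (EFin \o f) by exact/measurable_EFinP.
pose f_ := nnsfun_approx measurableT mEf.
have Ef0 x : setT x -> 0 <= (EFin \o f) x by move=> _; rewrite lee_fin.
have cf x : (f_ n x)%:E @[n --> \oo] --> (f x)%:E.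
  by have := @cvg_nnsfun_approx _ _ _ _ measurableT _ mEf Ef0 x I.
have nd x (a b : nat) : (a <= b)%N -> (f_ a x <= f_ b x)%R.
  by move=> ab; exact/lefP/nd_nnsfun_approx.
transitivity (limn (fun n => \int[P]_w (U w * f_ n (Z w))%:E)).
  rewrite -monotone_convergence//=.
  - apply: eq_integral => w _; apply/esym/cvg_lim => //=.
    rewrite EFinM; under eq_fun do rewrite EFinM.
    by apply: cvgeZl => //; exact: cf.
  - move=> n; apply/measurable_EFinP/measurable_funM => //.
    exact: measurableT_comp.
  - by move=> n w _; rewrite lee_fin mulr_ge0.
  - by move=> w _ a b ab; rewrite lee_fin ler_wpM2l// nd.
under eq_fun do rewrite decoupled_simple.
rewrite (_ : \int[m]_x (f x)%:E = limn (fun n => \int[m]_x (f_ n x)%:E)).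
  rewrite -limeMl//; apply: ereal_nondecreasing_is_cvgn => a b ab.
  apply: ge0_le_integral => //=.
  - by move=> x _; rewrite lee_fin.
  - exact/measurable_EFinP.
  - exact/measurable_EFinP.
  - by move=> x _; rewrite lee_fin nd.
rewrite -monotone_convergence//=.
- by apply: eq_integral => x _; apply/esym/cvg_lim => //; exact: cf.
- by move=> n; exact/measurable_EFinP.
- by move=> n x _; rewrite lee_fin.
- by move=> x _ a b ab; rewrite lee_fin nd.
Qed.

End DecoupledIntegral.

Section ProductRule.
Context d (T : measurableType d) (R : realType) (P : probability T R).

(** Independence is a product rule for events, so the factors are turned from
    indicators into functions one at a time: the induction is on the indices
    that already carry a function, while an indicator of a cylinder over the
    remaining indices stays in the integrand. *)
Lemma expectation_prod_independent (I : finType) (Z : I -> {RV P >-> R})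
    (h : I -> R -> R) :
    mutually_independent Z ->
    (forall i, measurable_fun setT (h i)) ->
    (forall i x, 0 <= h i x) ->
    (forall i, (\int[P]_w (h i (Z i w))%:E)%E \is a fin_num) ->
  (\int[P]_w (\prod_i h i (Z i w))%:E = \prod_i \int[P]_w (h i (Z i w))%:E)%E.
Proof.
move=> indZ mh h0 fin.
pose cyl (J : {set I}) (B : I -> set R) := \bigcap_(i in [set` J]) (Z i @^-1` B i).
have mcyl (J : {set I}) (B : I -> set R) :
    (forall i, i \in J -> measurable (B i)) -> measurable (cyl J B).
  move=> mB; apply: fin_bigcap_measurable => [|i /= iJ].
    exact: finite_finset.
  by rewrite -[X in measurable X]setTI; apply: measurable_funP => //; exact: mB.
suff main (s : seq I) (J : {set I}) (B : I -> set R) : uniq s ->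
    (forall i, i \in s -> i \notin J) ->
    (forall i, i \in J -> measurable (B i)) ->
    (\int[P]_w ((\prod_(i <- s) h i (Z i w)) * \1_(cyl J B) w)%R%:E =
     (\prod_(i <- s) \int[P]_w (h i (Z i w))%:E) * P (cyl J B))%E.
  have cyl0 : cyl finset.set0 (fun=> setT) = setT.
    by rewrite /cyl; apply/seteqP; split => // w _ i /=.
  have := main (index_enum I) finset.set0 (fun=> setT) (index_enum_uniq I).
  rewrite cyl0 probability_setT mule1 => <-//.
    by apply: eq_integral => w _; rewrite indicT mulr1.
  by move=> i _; rewrite finset.in_set0.
elim: s J B => [|i s IH] J B /=.
  move=> _ _ mB; rewrite big_nil mul1e.
  under eq_integral do rewrite big_nil mul1r.
  by rewrite integral_indic ?setIT//; exact: mcyl.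
move=> /andP[i_s us] sJ mB.
have iJ : i \notin J by apply: sJ; rewrite mem_head.
have sJ' k : k \in s -> k \notin J by move=> ks; apply: sJ; rewrite inE ks orbT.
pose U w := (\prod_(i <- s) h i (Z i w)) * \1_(cyl J B) w.
pose c := (\int[P]_w (U w)%:E)%E.
have cE : c = ((\prod_(i <- s) \int[P]_w (h i (Z i w))%:E) * P (cyl J B))%E.
  exact: IH.
have U0 w : 0 <= U w by rewrite mulr_ge0// prodr_ge0.
have mU : measurable_fun setT U.
  apply: measurable_funM.
    by apply: measurable_prod => k _; exact: measurableT_comp.
  exact/measurable_indic/mcyl.
transitivity (\int[P]_w (U w * h i (Z i w))%:E)%E.
  by apply: eq_integral => w _; rewrite big_cons /U -mulrA mulrC.
rewrite (@decoupled_integral _ _ _ _ (distribution P (Z i)) U (Z i) c)//.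
- rewrite big_cons cE muleC muleA; congr (_ * _ * _)%E.
  rewrite ge0_integral_distribution//; first exact/measurable_EFinP.
  by move=> y; rewrite lee_fin.
- rewrite cE fin_numM// ?fin_num_measure//; last exact: mcyl.
  apply: (big_ind (fun x : \bar R => x \is a fin_num)) => // x y xf yf.
  by rewrite fin_numM.
- move=> B1 mB1.
  pose J' := (i |: J)%SET.
  pose B' k := if k == i then B1 else B k.
  have B'i : B' i = B1 by rewrite /B' eqxx.
  have B'J k : k \in J -> B' k = B k.
    by rewrite /B'; case: eqP => // ->; rewrite (negbTE iJ).
  have mB' k : k \in J' -> measurable (B' k).
    rewrite !inE => /orP[/eqP ->|kJ]; first by rewrite B'i.
    by rewrite B'J//; exact: mB.
  have cylE : cyl J' B' = (Z i @^-1` B1) `&` cyl J B.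
    apply/seteqP; split => w /=.
      move=> H; split.
        by have := H i; rewrite /= B'i; apply; rewrite !inE eqxx.
      by move=> k /= kJ; rewrite -B'J//; apply: H; rewrite /= !inE kJ orbT.
    move=> [H1 H2] k /=; rewrite !inE => /orP[/eqP ->|kJ]; first by rewrite B'i.
    by rewrite B'J//; exact: H2.
  have PcylE : P (cyl J' B') = (P (cyl J B) * P (Z i @^-1` B1))%E.
    rewrite /cyl indZ// indZ// /J' big_setU1//= muleC B'i; congr (_ * _)%E.
    by apply: eq_bigr => k kJ; rewrite B'J.
  rewrite cE -muleA /distribution /pushforward -PcylE -IH//.
    apply: eq_integral => w _; congr EFin; rewrite /U -mulrA cylE indicI /=.
    by rewrite mulrC [in RHS]mulrC; congr (_ * _); rewrite mulrC.
  move=> k ks; rewrite !inE negb_or sJ'// andbT.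
  by apply: contraNneq i_s => <-.
Qed.

End ProductRule.

(** * Chernoff's bound for sums of independent copies *)
Section Chernoff.
Context (R : realType).

Lemma mutually_independent_inj d (T : measurableType d) (P : probability T R)
    (I I' : finType) (f : I' -> I) (Z : I -> {RV P >-> R}) :
  injective f -> mutually_independent Z -> mutually_independent (Z \o f).
Proof.
move=> f_inj indZ J B mB.
have [B' B'f] : exists B' : I -> set R, forall i, B' (f i) = B i.
  exists (fun k => if [pick i | f i == k] is Some i then B i else setT) => i.
  by case: pickP => [j /eqP/f_inj ->//|/(_ i)]; rewrite eqxx.
have := indZ (f @: J)%SET B'; rewrite big_imset/=; last by move=> *; exact: f_inj.
under eq_bigr do rewrite B'f.
move=> <-.
  congr (P _); apply/seteqP; split => w /= H i /=.
    by move=> /imsetP[j jJ ->] /=; rewrite B'f; exact: H.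
  by move=> iJ; rewrite -B'f; apply: H => /=; exact: imset_f.
by move=> i /imsetP[j jJ ->]; rewrite B'f; exact: mB.
Qed.

Context d0 (T0 : measurableType d0) (P0 : probability T0 R) (X0 : {RV P0 >-> R}).
Context d (T : measurableType d) (P : probability T R).

Lemma bounded_integrable d1 (S : measurableType d1) (Q : probability S R)
    (f : S -> R) (M : R) :
  measurable_fun setT f -> (forall x, `|f x| <= M) ->
  Q.-integrable setT (EFin \o f).
Proof.
move=> mf fM; apply: (@le_integrable _ _ _ Q setT measurableT _ (EFin \o cst M)).
- exact/measurable_EFinP.
- move=> x _ /=; rewrite lee_fin (le_trans (fM x))// ler_norm//.
- exact: finite_measure_integrable_cst.
Qed.

Lemma integral_identically_distributed (Z : {RV P >-> R}) (f : R -> R) :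
    identically_distributed Z X0 -> measurable_fun setT f ->
    (forall x, 0 <= f x) ->
  (\int[P]_w (f (Z w))%:E = \int[P0]_w (f (X0 w))%:E)%E.
Proof.
move=> ZX mf f0; have mEf : measurable_fun setT (EFin \o f) by exact/measurable_EFinP.
rewrite -(ge0_integral_distribution Z mEf)//.
rewrite -(ge0_integral_distribution X0 mEf)//.
by apply: eq_measure_integral => B mB _; exact: ZX.
Qed.

Lemma chernoff_iid (I : finType) (Z : I -> {RV P >-> R}) (g : R -> R) (M t : R) :
    mutually_independent Z ->
    (forall i, identically_distributed (Z i) X0) ->
    measurable_fun setT g -> (forall x, `|g x| <= M) ->
  (P [set w | (t <= \sum_i g (Z i w))%R]
   <= (expR (- t) * (\int[P0]_w expR (g (X0 w))) ^+ #|I|)%:E)%E.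
Proof.
move=> indZ idZ mg gM.
pose S w := \sum_i g (Z i w).
have mS : measurable_fun setT S.
  by apply: measurable_sum => i; exact: measurableT_comp.
pose SRV : {RV P >-> R} := mfun_Sub (mem_set mS : S \in mfun).
have := @chernoff _ _ _ P SRV 1 t ltr01.
rewrite mul1r => /le_trans; apply.
rewrite EFinM muleC lee_wpmul2l// ?lee_fin ?expR_ge0//.
rewrite /mmt_gen_fun unlock.
have meg : measurable_fun setT (expR \o g) by exact: measurableT_comp.
have intE i : (\int[P]_w (expR (g (Z i w)))%:E = (\int[P0]_w expR (g (X0 w)))%:E)%E.
  rewrite (@integral_identically_distributed (Z i) (expR \o g))//=.
  rewrite /Rintegral fineK//; apply: integrable_fin_num => //.
  apply: (@bounded_integrable _ _ _ _ (expR M)).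
    exact: (measurableT_comp meg).
  move=> w; rewrite ger0_norm ?expR_ge0// ler_expR.
  exact: le_trans (ler_norm _) (gM _).
rewrite (eq_integral (fun w => (\prod_i (expR \o g) (Z i w))%:E)); last first.
  by move=> w _ /=; rewrite mulr1 expR_sum.
rewrite (@expectation_prod_independent _ _ _ _ _ _ (fun=> expR \o g))//.
- under eq_bigr do rewrite intE.
  by rewrite prodEFin prodr_const.
- by move=> i x; exact: expR_ge0.
- by move=> i; rewrite intE.
Qed.

End Chernoff.

(** * The clipping function *)
Section Clipping.
Context (R : realType).
Implicit Types a b x y : R.

Lemma phi_le a b x y : a <= b -> x <= y -> phi a b x <= phi a b y.
Proof.
by rewrite /phi => ab xy; case: (ltP b x); case: (ltP b y) => ? ?;
  rewrite ?lexx//; (try (case: ltP => ?)); (try (case: ltP => ?)); lra.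
Qed.

Lemma phi_ge_lb a b x : a <= b -> a <= phi a b x.
Proof. by rewrite /phi => ab; case: (ltP b x) => // _; case: (ltP x). Qed.

Lemma phi_le_ub a b x : a <= b -> phi a b x <= b.
Proof. by rewrite /phi => ab; case: (ltP b x) => // ?; case: (ltP x). Qed.

Lemma normr_phi_le a b x : a <= b -> `|phi a b x| <= `|a| + `|b|.
Proof.
move=> ab; have := phi_ge_lb x ab; have := phi_le_ub x ab.
have := ler_norm b; have := ler_norm (- a); have := normr_ge0 b.
have := normr_ge0 a; rewrite normrN ler_norml.
by move=> *; apply/andP; split; lra.
Qed.

Lemma phi_contraction a b x y : a <= b -> `|phi a b x - phi a b y| <= `|x - y|.
Proof.
move=> ab; wlog xy : x y / y <= x.
  by move=> H; case: (leP y x) => [/H//|/ltW/H]; rewrite distrC (distrC x).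
rewrite !ger0_norm ?subr_ge0//; last exact: phi_le.
by rewrite /phi; case: (ltP b x); case: (ltP b y) => ? ?;
  (try (case: ltP => ?)); (try (case: ltP => ?)); lra.
Qed.

End Clipping.

(** * Expectations of linear combinations *)
Section Expectation.
Context (R : realType) d (T : measurableType d) (Q : probability T R).
Implicit Types (f g Z : T -> R).

Local Notation Ex f := (\int[Q]_w f w)%R.
Local Notation L1 f := (Q.-integrable [set: T] (EFin \o f)).

Lemma indic_boolE (p : T -> bool) w : \1_[set w | p w] w = (p w)%:R :> R.
Proof. by rewrite indicE; congr (_%:R); apply: congr1; apply/idP/idP; rewrite inE. Qed.

Lemma integrableZ_EFin c f : L1 f -> L1 (fun w => c * f w).
Proof. by move=> If; have := integrableZl measurableT c If; exact. Qed.

Lemma integrableD_EFin f g : L1 f -> L1 g -> L1 (fun w => f w + g w).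
Proof. by move=> If Ig; have := integrableD measurableT If Ig; exact. Qed.

Lemma integrable_cst_EFin c : L1 (fun=> c).
Proof. exact: finite_measure_integrable_cst. Qed.

(** Moment inequalities below are obtained by integrating a pointwise (in)equality
    between a few fixed functions; this lemma and the next one do so without
    repeating the integrability bookkeeping. *)
Lemma Rintegral_lincomb c0 c1 c2 c3 c4 c5 f1 f2 f3 f4 f5 :
    L1 f1 -> L1 f2 -> L1 f3 -> L1 f4 -> L1 f5 ->
  Ex (fun w => c0 + c1 * f1 w + c2 * f2 w + c3 * f3 w + c4 * f4 w + c5 * f5 w) =
  c0 + c1 * Ex f1 + c2 * Ex f2 + c3 * Ex f3 + c4 * Ex f4 + c5 * Ex f5.
Proof.
move=> I1 I2 I3 I4 I5; have I0 := integrable_cst_EFin c0.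
have J1 := integrableZ_EFin c1 I1; have J2 := integrableZ_EFin c2 I2.
have J3 := integrableZ_EFin c3 I3; have J4 := integrableZ_EFin c4 I4.
have J5 := integrableZ_EFin c5 I5.
have K1 := integrableD_EFin I0 J1; have K2 := integrableD_EFin K1 J2.
have K3 := integrableD_EFin K2 J3; have K4 := integrableD_EFin K3 J4.
rewrite RintegralD// RintegralD// RintegralD// RintegralD// RintegralD//.
rewrite !RintegralZl// Rintegral_cst//.
rewrite [X in c0 * X](_ : _ = 1) ?mulr1//.
by rewrite -[RHS]/(fine 1%:E) -(probability_setT Q).
Qed.

Lemma Rintegral_lincomb_ge0 c0 c1 c2 c3 f1 f2 f3 :
    L1 f1 -> L1 f2 -> L1 f3 ->
    (forall w, 0 <= c0 + c1 * f1 w + c2 * f2 w + c3 * f3 w) ->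
  0 <= c0 + c1 * Ex f1 + c2 * Ex f2 + c3 * Ex f3.
Proof.
move=> I1 I2 I3 H.
have := Rintegral_lincomb c0 c1 c2 c3 0 0 I1 I2 I3 I1 I1.
rewrite !mul0r !addr0 => <-; apply: Rintegral_ge0 => w _.
by rewrite !mul0r !addr0.
Qed.

Lemma measurable_ltset Z c : measurable_fun setT Z ->
  measurable [set w | c < Z w].
Proof.
move=> mZ; have := mZ measurableT _ (measurable_itv `]c, +oo[).
by rewrite setTI; congr measurable; apply/seteqP; split => w /=; rewrite in_itv/= andbT.
Qed.

Lemma measurable_leset Z c : measurable_fun setT Z ->
  measurable [set w | Z w <= c].
Proof.
move=> mZ; have := mZ measurableT _ (measurable_itv `]-oo, c]).
by rewrite setTI; congr measurable; apply/seteqP; split => w /=; rewrite in_itv/=.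
Qed.

Lemma measurable_fun_bool Z (A : pred R) : measurable [set w | A (Z w)] ->
  measurable_fun setT (fun w => (A (Z w))%:R : R).
Proof.
move=> mA; rewrite (_ : (fun w => _) = \1_[set w | A (Z w)]).
  exact: measurable_indic.
by apply/funext => w; rewrite indic_boolE.
Qed.

Lemma measurable_geset Z c : measurable_fun setT Z ->
  measurable [set w | c <= Z w].
Proof.
move=> mZ; have := mZ measurableT _ (measurable_itv `[c, +oo[).
rewrite setTI; congr measurable.
by apply/seteqP; split => w /=; rewrite in_itv/= andbT.
Qed.

Lemma integrable_indic A : measurable A -> L1 (\1_A).
Proof.
move=> mA; apply: (@bounded_integrable _ _ _ _ _ 1); first exact: measurable_indic.
by move=> x; rewrite ger0_norm// indicE; case: (_ \in _).
Qed.

Lemma integrable_mul_indic Z A : L1 Z -> measurable A ->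
  L1 (fun w => Z w * \1_A w).
Proof.
move=> IZ mA; apply: (@le_integrable _ _ _ Q setT measurableT _ (EFin \o Z)) => //.
  apply/measurable_EFinP/measurable_funM; last exact: measurable_indic.
  by apply/measurable_EFinP; case/integrableP: IZ.
move=> x _ /=; rewrite lee_fin normrM indicE.
by case: (_ \in _); rewrite ?normr1 ?mulr1 ?normr0 ?mulr0.
Qed.

Lemma Rintegral_indic A : measurable A -> Ex (\1_A) = fine (Q A).
Proof. by move=> mA; rewrite /Rintegral integral_indic ?setIT. Qed.

End Expectation.

(** * Truncated moments of a centered law *)
Section CenteredLaw.
Context (R : realType) d (T : measurableType d) (Q : probability T R).
Context (Z : T -> R) (sigma : R).
Hypothesis mZ : measurable_fun setT Z.
Hypothesis iZ : Q.-integrable [set: T] (EFin \o Z).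
Hypothesis Z0 : \int[Q]_w Z w = 0.
Hypothesis iZ2 : Q.-integrable [set: T] (EFin \o (fun w => Z w ^+ 2)).
Hypothesis Z2 : \int[Q]_w (Z w ^+ 2) = sigma ^+ 2.

Local Notation Ex f := (\int[Q]_w f w)%R.
Local Notation L1 f := (Q.-integrable [set: T] (EFin \o f)).

(** Cauchy-Schwarz, from the nonnegativity of the mean of (Z - l 1_A)^2 as a
    polynomial in l. *)
Lemma sqr_truncated_mean_le A q : measurable A -> Q A = q%:E ->
  (Ex (fun w => Z w * \1_A w)) ^+ 2 <= sigma ^+ 2 * q.
Proof.
move=> mA QA; set e := Ex _.
have iA := integrable_indic Q mA; have iZA := integrable_mul_indic iZ mA.
have q0 : 0 <= q by rewrite -lee_fin -QA.
have key l : 0 <= 0 + 1 * sigma ^+ 2 + (- 2 * l) * e + l ^+ 2 * q.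
  have := @Rintegral_lincomb_ge0 _ _ _ Q 0 1 (- 2 * l) (l ^+ 2) _ _ _ iZ2 iZA iA.
  rewrite Z2 Rintegral_indic// QA; apply => w.
  rewrite indicE; case: (_ \in _); rewrite /= ?mulr1 ?mulr0.
    suff -> : 0 + 1 * Z w ^+ 2 + - 2 * l * Z w + l ^+ 2 = (Z w - l) ^+ 2 by exact: sqr_ge0.
    by ring.
  by rewrite add0r mul1r !addr0 sqr_ge0.
(* e / q minimizes the quadratic; when q = 0 the polynomial is affine in l, hence
   e = 0, since otherwise this value of l makes it negative. *)
have := key (e / q); have [q_eq0|q_neq0] := eqVneq q 0.
  move=> _; rewrite q_eq0 mulr0.
  have [->|e0] := eqVneq e 0; first by rewrite expr0n.
  have := key ((sigma ^+ 2 + 1) / e); rewrite q_eq0 mulr0 addr0.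
  rewrite (_ : _ + _ + _ = - sigma ^+ 2 - 2); last by field.
  by have := sqr_ge0 sigma; lra.
rewrite (_ : _ + _ + _ + _ = (sigma ^+ 2 * q - e ^+ 2) / q); last by field.
by rewrite pmulr_lge0 ?subr_ge0// invr_gt0 lt_neqAle eq_sym q_neq0.
Qed.

Section Levels.
Context (a b p theta : R).
Hypothesis Qa : Q [set w | Z w <= a] = p%:E.
Hypothesis Qb : Q [set w | b < Z w] = theta%:E.

Let A := [set w | Z w <= a].
Let B := [set w | b < Z w].
Let mA : measurable A. Proof. exact: measurable_leset. Qed.
Let mB : measurable B. Proof. exact: measurable_ltset. Qed.
Let iA : L1 (\1_A). Proof. exact: integrable_indic. Qed.
Let iB : L1 (\1_B). Proof. exact: integrable_indic. Qed.
Let iZA : L1 (fun w => Z w * \1_A w). Proof. exact: integrable_mul_indic. Qed.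
Let iZB : L1 (fun w => Z w * \1_B w). Proof. exact: integrable_mul_indic. Qed.
Let ExA : Ex (\1_A) = p. Proof. by rewrite Rintegral_indic// Qa. Qed.
Let ExB : Ex (\1_B) = theta. Proof. by rewrite Rintegral_indic// Qb. Qed.
Let AE w : \1_A w = (Z w <= a)%R%:R :> R. Proof. exact: indic_boolE. Qed.
Let BE w : \1_B w = (b < Z w)%R%:R :> R. Proof. exact: indic_boolE. Qed.

(** These two first moments carry all the information on the tails: since
    P(Z <= a) = p and P(Z > b) = theta, the mean of (a - Z)^+ is p a + lower_mass
    and the mean of (Z - b)^+ is upper_mass - theta b. *)
Definition lower_mass := - Ex (fun w => Z w * \1_A w).
Definition upper_mass := Ex (fun w => Z w * \1_B w).
Local Notation S := lower_mass.
Local Notation H := upper_mass.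

Lemma lower_excess_ge0 : 0 <= p * a + S.
Proof.
have := @Rintegral_lincomb_ge0 _ _ _ Q 0 a (-1) 0 _ _ _ iA iZA iA.
rewrite ExA mul0r addr0 add0r mulrC mulN1r; apply => w.
by rewrite AE; case: (leP (Z w)) => ? /=; lra.
Qed.

Lemma upper_excess_ge0 : 0 <= H - theta * b.
Proof.
have := @Rintegral_lincomb_ge0 _ _ _ Q 0 (-b) 1 0 _ _ _ iB iZB iB.
rewrite ExB mul0r addr0 add0r mul1r addrC mulNr [b * _]mulrC; apply => w.
by rewrite BE; case: (ltP b) => ? /=; lra.
Qed.

(** As Z has mean 0, S is also the mean of Z over the event Z > a. *)
Lemma level_le_lower_mass : a * (1 - p) <= S.
Proof.
have := @Rintegral_lincomb_ge0 _ _ _ Q (-a) 1 a (-1) _ _ _ iZ iA iZA.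
rewrite ExA Z0 => H0; suff: 0 <= - a + 1 * 0 + a * p - 1 * - S by lra.
rewrite opprK mulNr in H0 *; apply: H0 => w.
by rewrite AE; case: (leP (Z w)) => ? /=; lra.
Qed.

Lemma sqr_lower_mass_le : S ^+ 2 <= sigma ^+ 2 * p.
Proof. by rewrite sqrrN; exact: sqr_truncated_mean_le. Qed.

Lemma sqr_upper_mass_le : H ^+ 2 <= sigma ^+ 2 * theta.
Proof. exact: sqr_truncated_mean_le. Qed.

Hypothesis ab : a <= b.

Let W w := phi a b (Z w).

Lemma clippedE w :
  W w = Z w + a * \1_A w - Z w * \1_A w - Z w * \1_B w + b * \1_B w.
Proof.
rewrite /W /phi AE BE; case: (ltP b (Z w)) => bZ.
  by rewrite leNgt (le_lt_trans ab bZ)/=; lra.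
by case: (ltgtP (Z w) a) => Za /=; lra.
Qed.

(** Clipping adds (a - Z)^+ to Z and subtracts (Z - b)^+. *)
Definition clipped_mean := p * a + S - (H - theta * b).
Local Notation e := clipped_mean.

Lemma Rintegral_clipped : Ex W = e.
Proof.
have := Rintegral_lincomb 0 1 a (-1) (-1) b iZ iA iZA iZB iB.
rewrite ExA ExB Z0 (_ : clipped_mean = 0 + 1 * 0 + a * p + -1 * - S + -1 * H + b * theta).
  rewrite opprK => <-; apply: eq_Rintegral => w _; rewrite clippedE; ring.
by rewrite /clipped_mean; ring.
Qed.

Lemma measurable_clipped : measurable_fun setT W.
Proof.
rewrite (_ : W = fun w => Z w + a * \1_A w - Z w * \1_A w - Z w * \1_B w + b * \1_B w).
  have m1A : measurable_fun setT (\1_A : T -> R) by exact: measurable_indic.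
  have m1B : measurable_fun setT (\1_B : T -> R) by exact: measurable_indic.
  apply: measurable_funD; last exact: measurable_funM.
  apply: measurable_funB; last exact: measurable_funM.
  apply: measurable_funB; last exact: measurable_funM.
  by apply: measurable_funD => //; exact: measurable_funM.
by apply/funext => w; rewrite clippedE.
Qed.

Let W_bnd w : `|W w| <= `|a| + `|b|. Proof. exact: normr_phi_le. Qed.

Lemma integrable_clipped : L1 W.
Proof. exact: bounded_integrable measurable_clipped W_bnd. Qed.

Lemma integrable_clipped_sqr : L1 (fun w => W w ^+ 2).
Proof.
apply: (@bounded_integrable _ _ _ _ _ ((`|a| + `|b|) ^+ 2)).
  exact: measurable_funX measurable_clipped.
by move=> w; rewrite normrX lerXn2r// nnegrE addr_ge0.
Qed.

(** Clipping is a contraction, so its variance is at most the second moment of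
    phi a b Z - phi a b 0, which is at most that of Z. *)
Lemma clipped_second_moment : Ex (fun w => W w ^+ 2) <= sigma ^+ 2 + e ^+ 2.
Proof.
pose c := phi a b 0.
have H0 : 0 <= - c ^+ 2 + 1 * sigma ^+ 2 + -1 * Ex (fun w => W w ^+ 2) + (2 * c) * e.
  rewrite -Rintegral_clipped -Z2.
  apply: (@Rintegral_lincomb_ge0 _ _ _ Q _ _ _ _ _ _ _ iZ2 integrable_clipped_sqr
    integrable_clipped) => w.
  suff : (W w - c) ^+ 2 <= (Z w) ^+ 2 by rewrite !expr2; lra.
  rewrite -(real_normK (num_real (W w - c))) -(real_normK (num_real (Z w))).
  rewrite lerXn2r ?nnegrE//.
  by rewrite -[X in _ <= `|X|]subr0; exact: phi_contraction.
by have := sqr_ge0 (c - e); rewrite sqrrB !expr2 in H0 *; lra.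
Qed.

End Levels.
End CenteredLaw.

(** * Exponential inequalities and moment generating functions *)
Section ExponentialBounds.
Context (R : realType).
Implicit Types x u : R.

(** The function (1 + y + y^2) exp (- y) has derivative y (1 - y) exp (- y), so 0
    is its minimum on the half-line y <= 1. *)
Lemma expR_le_quadratic x : x <= 1 -> expR x <= 1 + x + x ^+ 2.
Proof.
move=> x1; pose g (y : R) := (1 + y + y ^+ 2) * expR (- y).
pose dg (y : R) := y * (1 - y) * expR (- y).
have dgE (y : R) : is_derive y 1 g (dg y).
  rewrite /g; apply: is_derive_eq.
  by rewrite /dg /GRing.scale /=; ring.
have cg (a b : R) : {within `[a, b], continuous g}.
  apply: continuous_subspaceT => y.
  by apply/differentiable_continuous/derivable1_diffP; case: (dgE y).
suff : g 0 <= g x.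
  rewrite /g oppr0 expR0 expr0n /= !addr0 mulr1 => H.
  by rewrite -[leLHS]mul1r -ler_pdivlMr ?expR_gt0// -expRN.
have [x0|x0] := leP 0 x.
  have [c + E] := MVT_segment x0 (fun y _ => dgE y) (@cg 0 x).
  rewrite in_itv /= => /andP[c0 cx]; rewrite -subr_ge0 E /dg.
  by rewrite !mulr_ge0 ?expR_ge0//; lra.
have [c + E] := MVT_segment (ltW x0) (fun y _ => dgE y) (@cg x 0).
rewrite in_itv /= => /andP[cx c0]; rewrite -subr_le0 E /dg.
rewrite mulr_le0_ge0//; last lra.
by rewrite mulr_le0_ge0 ?expR_ge0// mulr_le0_ge0//; lra.
Qed.

(** The function (1 - y) exp (y + y^2 / 2) has derivative - y^2 exp (y + y^2 / 2). *)
Lemma onem_le_expR_quadratic u : 0 <= u -> 1 - u <= expR (- (u + u ^+ 2 / 2)).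
Proof.
move=> u0; pose g (y : R) := (1 - y) * expR (y + y ^+ 2 / 2).
pose dg (y : R) := - y ^+ 2 * expR (y + y ^+ 2 / 2).
have dgE (y : R) : is_derive y 1 g (dg y).
  rewrite /g; apply: is_derive_eq.
  by rewrite /dg /GRing.scale /=; field.
have cg (a b : R) : {within `[a, b], continuous g}.
  apply: continuous_subspaceT => y.
  by apply/differentiable_continuous/derivable1_diffP; case: (dgE y).
rewrite expRN -[leRHS]mul1r ler_pdivlMr ?expR_gt0//.
suff : g u <= g 0 by rewrite /g expr0n /= mul0r addr0 expR0 subr0 mulr1.
have [c + E] := MVT_segment u0 (fun y _ => dgE y) (@cg 0 u).
rewrite in_itv /= => /andP[c0 cu]; rewrite -subr_le0 E /dg subr0 mulNr.
by rewrite mulNr oppr_le0 !mulr_ge0 ?expR_ge0 ?sqr_ge0.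
Qed.

End ExponentialBounds.

Section MomentGeneratingBounds.
Context (R : realType) d (T : measurableType d) (Q : probability T R).
Context (Z : T -> R) (sigma : R).
Hypothesis mZ : measurable_fun setT Z.

Local Notation Ex f := (\int[Q]_w f w)%R.
Local Notation L1 f := (Q.-integrable [set: T] (EFin \o f)).

Lemma mgf_indicator (A : pred R) q s : measurable [set w | A (Z w)] ->
    Q [set w | A (Z w)] = q%:E ->
  Ex (fun w => expR (s * (A (Z w))%:R)) = 1 - q * (1 - expR s).
Proof.
move=> mA QA; have iA := integrable_indic Q mA.
have := Rintegral_lincomb 1 (expR s - 1) 0 0 0 0 iA iA iA iA iA.
rewrite Rintegral_indic// QA /= !mul0r !addr0.
rewrite (_ : 1 + _ = 1 - q * (1 - expR s)); last by ring.
move=> <-; apply: eq_Rintegral => w _; rewrite !mul0r !addr0 indic_boolE.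
by case: (A (Z w)) => /=; rewrite ?mulr1 ?mulr0 ?expR0; ring.
Qed.

Hypothesis iZ : L1 Z.
Hypothesis Z0 : Ex Z = 0.
Hypothesis iZ2 : L1 (fun w => Z w ^+ 2).
Hypothesis Z2 : Ex (fun w => Z w ^+ 2) = sigma ^+ 2.
Context (a b p theta : R).
Hypothesis Qa : Q [set w | Z w <= a] = p%:E.
Hypothesis Qb : Q [set w | b < Z w] = theta%:E.
Hypothesis ab : a <= b.

Local Notation e := (clipped_mean Q Z a b p theta).

(** The upper bound b - e on the centered clipped variable is enough, because the
    quadratic bound on the exponential holds on a half-line. *)
Lemma mgf_clipped s : 0 <= s -> s * (b - e) <= 1 ->
  Ex (fun w => expR (s * (phi a b (Z w) - e))) <= expR (s ^+ 2 * sigma ^+ 2).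
Proof.
move=> s0 sb; apply: le_trans (expR_ge1Dx _).
have mW := measurable_clipped mZ ab.
have iW := integrable_clipped Q mZ ab; have iW2 := integrable_clipped_sqr Q mZ ab.
pose E w := expR (s * (phi a b (Z w) - e)).
have iE : L1 E.
  apply: (@bounded_integrable _ _ _ _ _ (expR 1)).
    apply: measurableT_comp => //; apply: measurable_funM => //.
    exact: measurable_funB.
  move=> w; rewrite ger0_norm ?expR_ge0// ler_expR (le_trans _ sb)//.
  by rewrite ler_wpM2l// lerB// phi_le_ub.
have := @Rintegral_lincomb_ge0 _ _ _ Q (1 - s * e + s ^+ 2 * e ^+ 2)
  (s - 2 * s ^+ 2 * e) (s ^+ 2) (-1) _ _ _ iW iW2 iE.
rewrite (Rintegral_clipped mZ iZ Z0 Qa Qb ab).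
have M2 := clipped_second_moment mZ iZ Z0 iZ2 Z2 Qa Qb ab.
have {}M2 := ler_wpM2l (sqr_ge0 s) M2.
move=> H; have {H} : 0 <= 1 - s * e + s ^+ 2 * e ^+ 2 + (s - 2 * s ^+ 2 * e) * e +
    s ^+ 2 * (\int[Q]_w phi a b (Z w) ^+ 2) + -1 * (Ex E).
  apply: H => w.
  have : E w <= 1 + s * (phi a b (Z w) - e) + (s * (phi a b (Z w) - e)) ^+ 2.
    apply: expR_le_quadratic; rewrite (le_trans _ sb)//.
    by rewrite ler_wpM2l// lerB// phi_le_ub.
  by rewrite -subr_ge0; congr (0 <= _); ring.
move: M2 (\int[Q]_w E w) => + I2.
move: (\int[Q]_w _) e => I1 e' M2 H; rewrite -subr_ge0.
have -> : 1 + s ^+ 2 * sigma ^+ 2 - I2 =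
  (s ^+ 2 * (sigma ^+ 2 + e' ^+ 2) - s ^+ 2 * I1) +
  (1 - s * e' + s ^+ 2 * e' ^+ 2 + (s - 2 * s ^+ 2 * e') * e' + s ^+ 2 * I1 + -1 * I2).
  by ring.
by rewrite addr_ge0// subr_ge0.
Qed.

End MomentGeneratingBounds.

Section NumericalBounds.
Context (R : realType).
Implicit Types eps : R.

Lemma expR1_le3 : expR 1 <= 3 :> R.
Proof. by apply: le_trans (expR_le_quadratic (lexx 1)) _; lra. Qed.

(** The bound is exp (1/2) >= (1 + 1/32)^16, evaluated by repeated squaring. *)
Lemma expRN_half_le : expR (- 2^-1) <= 153 / 250 :> R.
Proof.
suff : 250 / 153 <= expR (2^-1) :> R.
  by rewrite expRN -(invrK (153 / 250)) lef_pV2 ?posrE ?expR_gt0 ?invr_gt0//; lra.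
have -> : 2^-1 = 16%:R * 32^-1 :> R by lra.
rewrite expRM_natl; rewrite (exprM _ 8 2) (exprM _ 4 2) (exprM _ 2 2).
have sqr_lb (x y z : R) : 0 <= y -> y <= x -> z <= y * y -> z <= x ^+ 2.
  by move=> y0 yx zy; rewrite (le_trans zy)// expr2 ler_pM.
apply: (sqr_lb _ (12787 / 10000)); [lra| |lra].
apply: (sqr_lb _ (11308 / 10000)); [lra| |lra].
apply: (sqr_lb _ (10634 / 10000)); [lra| |lra].
by apply: (sqr_lb _ (1 + 32^-1)); [lra|exact: expR_ge1Dx|lra].
Qed.

(** The mass p = 2 eps - (4/5) eps^2 below the lower level a is a compromise.  It
    must be large for more than (5/4) eps N sample points to fall below a
    (lower_level_rate), but less than 2 eps, so that a stays inside the tail of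
    mass 2 eps, and at most (1 + 6 eps) / 5, so that a cannot be large when
    positive (deviation_le_tail); (1 + 6 eps) / 5 - p is (1 - 2 eps)^2 / 5, so
    there is no room left at eps = 1/2. *)
Lemma lower_level_ge0 eps : 0 <= eps -> eps <= 1 / 2 ->
  0 <= 2 * eps - 4 / 5 * eps ^+ 2.
Proof. by move=> e0 e1; have := ler_wpM2l e0 e1; rewrite expr2; lra. Qed.

Lemma lower_level_le eps : 0 <= eps -> eps <= 1 / 2 ->
  2 * eps - 4 / 5 * eps ^+ 2 <= 4 / 5.
Proof.
move=> e0 e1; have : 0 <= (1 / 2 - eps) * (2 - eps) by rewrite mulr_ge0//; lra.
by rewrite expr2; lra.
Qed.

(** Here 97/250 bounds 1 - exp (- 1/2) from below and 17/24 = 5/8 + 1/12, where 5/8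
    is spent on the threshold (5/4) eps N and 1/12 is the rate to be achieved.
    The quadratic term is indispensable when eps is close to 1/2. *)
Lemma lower_level_rate eps (u := (2 * eps - 4 / 5 * eps ^+ 2) * (97 / 250)) :
  0 <= eps -> eps <= 1 / 2 -> 17 / 24 * eps <= u + u ^+ 2 / 2.
Proof.
move=> e0 e1; rewrite /u; set v := (2 - 4 / 5 * eps) * (97 / 250).
have -> : (2 * eps - 4 / 5 * eps ^+ 2) * (97 / 250) = eps * v by rewrite /v; field.
have v0 : 776 / 1250 <= v by rewrite /v; lra.
have vE : v = 776 / 1000 - 388 / 1250 * eps by rewrite /v; field.
rewrite -subr_ge0.
have -> : eps * v + (eps * v) ^+ 2 / 2 - 17 / 24 * eps =
  eps * (v + eps * v ^+ 2 / 2 - 17 / 24) by field.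
rewrite mulr_ge0//.
have : eps * (776 / 1250) ^+ 2 <= eps * v ^+ 2.
  by rewrite ler_wpM2l// lerXn2r// nnegrE; lra.
move: (eps * v ^+ 2) vE => q ->; lra.
Qed.

End NumericalBounds.

(** * Exponential tails of the counts and of the clipped sum *)
Section Tails.
Context (R : realType).
Context d0 (T0 : measurableType d0) (P0 : probability T0 R) (X0 : {RV P0 >-> R}).
Context d (T : measurableType d) (P : probability T R).
Context (N : nat) (V : 'I_N -> {RV P >-> R}).
Hypothesis indV : mutually_independent V.
Hypothesis idV : forall i, identically_distributed (V i) X0.
Context (h : R -> R) (mh : measurable_fun setT h).
Context (sigma eps L a b : R).
Hypothesis eps_ge0 : 0 <= eps.
Hypothesis eps_le : eps <= 1 / 2.
Hypothesis L_ge0 : 0 <= L.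

Let Z w := h (X0 w).
Let p := 2 * eps - 4 / 5 * eps ^+ 2.
Let theta := eps / 4.
Hypothesis Qa : P0 [set w | Z w <= a] = p%:E.
Hypothesis Qb : P0 [set w | b < Z w] = theta%:E.

Let mZ : measurable_fun setT Z. Proof. exact: measurableT_comp. Qed.

Let expR_powN (x : R) : expR x ^+ #|'I_N| = expR (N%:R * x).
Proof. by rewrite card_ord expRM_natl. Qed.

(** Chernoff's method with parameter - 1/2.  The term 3 L of the threshold, which
    comes from the corruption budget, yields the factor exp (- 3 L / 2). *)
Lemma few_below_tail :
  (P [set w | (\sum_i (h (V i w) <= a)%R%:R <= 5 / 4 * (eps * N%:R) - 3 * L)%R]
   <= (expR (- (eps * N%:R / 12) - 3 / 2 * L))%:E)%E.
Proof.
pose g x : R := - 2^-1 * (h x <= a)%R%:R.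
have mg : measurable_fun setT g.
  apply: measurable_funM => //.
  apply: (measurable_fun_bool (Z := h) (A := fun x => x <= a)).
  exact: measurable_leset.
have gM x : `|g x| <= 1.
  by rewrite /g normrM normrN !ger0_norm ?invr_ge0//; case: (h x <= a); rewrite /=; lra.
have := chernoff_iid (- 2^-1 * (5 / 4 * (eps * N%:R) - 3 * L)) indV idV mg gM.
rewrite (_ : [set w | (_ <= \sum_i g (V i w))%R] =
    [set w | \sum_i (h (V i w) <= a)%R%:R <= 5 / 4 * (eps * N%:R) - 3 * L]); last first.
  apply/seteqP; split => w /=; rewrite -mulr_sumr; lra.
move/le_trans; apply; rewrite lee_fin.
have := @mgf_indicator _ _ _ P0 Z (fun x => x <= a) p (- 2^-1) (measurable_leset a mZ) Qa.
rewrite /= -/(g _) => ->.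
have p0 : 0 <= p by exact: lower_level_ge0.
pose u := p * (97 / 250).
have u0 : 0 <= u by rewrite mulr_ge0//; lra.
have p1 : p <= 4 / 5 by exact: lower_level_le.
have base : 1 - p * (1 - expR (- 2^-1)) <= expR (- (17 / 24 * eps)).
  apply: (@le_trans _ _ (1 - u)).
    rewrite lerB// ler_wpM2l//.
    by have := @expRN_half_le R; lra.
  apply: (le_trans (onem_le_expR_quadratic u0)).
  by rewrite ler_expR lerN2 lower_level_rate.
apply: (@le_trans _ _ (expR (- (- 2^-1 * (5 / 4 * (eps * N%:R) - 3 * L))) *
    expR (- (17 / 24 * eps)) ^+ #|'I_N|)).
  rewrite ler_wpM2l ?expR_ge0// lerXn2r// nnegrE ?expR_ge0//.
  have : p * (1 - expR (- 2^-1)) <= 4 / 5 * 1.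
    by rewrite ler_pM// ?subr_ge0 ?expR_le1 ?gerBl ?expR_ge0//; lra.
  by lra.
by rewrite expR_powN -expRD ler_expR; lra.
Qed.

Lemma many_above_tail :
  (P [set w | (3 / 4 * (eps * N%:R) + 3 * L <= \sum_i (b < h (V i w))%R%:R)%R]
   <= (expR (- (eps * N%:R / 12) - 3 / 2 * L))%:E)%E.
Proof.
pose g x : R := (b < h x)%R%:R.
have mg : measurable_fun setT g.
  apply: (measurable_fun_bool (Z := h) (A := fun x => b < x)).
  exact: measurable_ltset.
have gM x : `|g x| <= 1 by rewrite /g ger0_norm//; case: (b < h x); rewrite /=; lra.
have := chernoff_iid (3 / 4 * (eps * N%:R) + 3 * L) indV idV mg gM.
move/le_trans; apply; rewrite lee_fin.
have := @mgf_indicator _ _ _ P0 Z (fun x => b < x) theta 1 (measurable_ltset b mZ) Qb.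
rewrite (@eq_Rintegral _ _ _ P0 setT (fun w => expR (g (X0 w)))) => [->|w _];
  last by rewrite mul1r.
have base : 1 - theta * (1 - expR 1) <= expR (eps / 2).
  apply: le_trans (expR_ge1Dx _).
  have /(ler_wpM2l eps_ge0) := @expR1_le3 R; rewrite /theta; lra.
apply: (@le_trans _ _ (expR (- (3 / 4 * (eps * N%:R) + 3 * L)) *
    expR (eps / 2) ^+ #|'I_N|)).
  rewrite ler_wpM2l ?expR_ge0// lerXn2r// nnegrE ?expR_ge0//.
  have : 0 <= theta * (expR 1 - 1).
    by rewrite mulr_ge0 ?subr_ge0 ?divr_ge0// -[leLHS]expR0 ler_expR.
  by lra.
have : 0 <= eps * N%:R by rewrite mulr_ge0.
by have := L_ge0; rewrite expR_powN -expRD ler_expR; lra.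
Qed.

Hypothesis iZ : P0.-integrable [set: T0] (EFin \o Z).
Hypothesis Z0 : \int[P0]_w Z w = 0.
Hypothesis iZ2 : P0.-integrable [set: T0] (EFin \o (fun w => Z w ^+ 2)).
Hypothesis Z2 : \int[P0]_w (Z w ^+ 2) = sigma ^+ 2.
Hypothesis ab : a <= b.
Hypothesis sigma_gt0 : 0 < sigma.

Local Notation e := (clipped_mean P0 Z a b p theta).

Lemma clipped_mean_le_ub : e <= b.
Proof.
rewrite -(Rintegral_clipped mZ iZ Z0 Qa Qb ab).
have iW := integrable_clipped P0 mZ ab.
have := @Rintegral_lincomb_ge0 _ _ _ P0 b (-1) 0 0 _ _ _ iW iW iW.
rewrite !mul0r !addr0 => H; suff: 0 <= b + -1 * \int[P0]_w phi a b (Z w) by lra.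
by apply: H => w; rewrite !mul0r !addr0; have := phi_le_ub (Z w) ab; lra.
Qed.

(** A form of Bernstein's inequality with a variance term 2 sigma tau and a range
    term 2 (b - e) tau^2. *)
Lemma clipped_sum_tail tau : 0 < tau ->
  (P [set w | (N%:R * (e + 2 * sigma * tau + 2 * (b - e) * tau ^+ 2) <=
               \sum_i phi a b (h (V i w)))%R]
   <= (expR (- (N%:R * tau ^+ 2)))%:E)%E.
Proof.
move=> tau_gt0; have tau0 := ltW tau_gt0; have eb := clipped_mean_le_ub.
(* The parameter tau / D satisfies both s (b - e) <= 1 and s sigma <= tau; as the
   deviation is 2 tau D, the exponent s^2 sigma^2 - 2 tau s D is at most
   tau^2 - 2 tau^2. *)
pose D := sigma + (b - e) * tau.
have D0 : 0 < D by rewrite ltr_pwDl// mulr_ge0// subr_ge0.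
pose s := tau / D.
have s_gt0 : 0 < s by rewrite divr_gt0.
have s0 := ltW s_gt0.
have sb : s * (b - e) <= 1.
  by rewrite /s mulrAC ler_pdivrMr// mul1r /D; have := sigma_gt0; lra.
have ss : s * sigma <= tau.
  rewrite /s mulrAC ler_pdivrMr// ler_wpM2l//.
  by rewrite /D lerDl mulr_ge0// subr_ge0.
have ssig : s ^+ 2 * sigma ^+ 2 <= tau ^+ 2.
  by rewrite -exprMn lerXn2r// nnegrE mulr_ge0// ltW.
pose g x : R := s * (phi a b (h x) - e).
have mg : measurable_fun setT g.
  apply: measurable_funM => //; apply: measurable_funB => //.
  exact: measurable_clipped.
have gM x : `|g x| <= s * (`|a| + `|b| + `|e|).
  rewrite /g normrM ger0_norm// ler_wpM2l//.
  rewrite (le_trans (ler_normB _ _))// lerD2r.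
  exact: normr_phi_le.
have := chernoff_iid (N%:R * (2 * tau ^+ 2)) indV idV mg gM.
rewrite (_ : [set w | (_ <= \sum_i g (V i w))%R] = [set w |
  N%:R * (e + 2 * sigma * tau + 2 * (b - e) * tau ^+ 2) <=
  \sum_i phi a b (h (V i w))]); last first.
  rewrite /g; apply/seteqP; split => w /=; rewrite -mulr_sumr sumrB sumr_const card_ord;
  (have -> : N%:R * (2 * tau ^+ 2) = s * (N%:R * (2 * tau * D)) by
    rewrite /s; field; rewrite gt_eqF);
  rewrite ler_pM2l// /D -mulr_natl; lra.
move/le_trans; apply; rewrite lee_fin.
have mgf := mgf_clipped mZ iZ Z0 iZ2 Z2 Qa Qb ab s0 sb.
apply: (@le_trans _ _ (expR (- (N%:R * (2 * tau ^+ 2))) *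
    expR (s ^+ 2 * sigma ^+ 2) ^+ #|'I_N|)).
  rewrite ler_wpM2l ?expR_ge0// lerXn2r// nnegrE ?expR_ge0//.
  by apply: Rintegral_ge0 => w _; exact: expR_ge0.
rewrite expR_powN -expRD ler_expR.
have : N%:R * (s ^+ 2 * sigma ^+ 2) <= N%:R * tau ^+ 2 by rewrite ler_wpM2l.
by lra.
Qed.

End Tails.

(** * Order statistics *)
Section OrderStatistics.
Context (R : realType) (N : nat).
Implicit Types (y : 'I_N -> R) (t : R) (k : nat).

Lemma count_sort_codom y (A : pred R) :
  count A (sort <=%R (codom y)) = (\sum_i A (y i))%N.
Proof. by rewrite count_sort count_map -sum1_count big_mkcond /= enumT. Qed.

Lemma size_sort_codom y : size (sort <=%R (codom y)) = N.
Proof. by rewrite size_sort size_codom card_ord. Qed.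

Lemma order_stat_le y k t : (0 < k)%N ->
  (k <= \sum_i (y i <= t)%R)%N -> order_stat y k <= t.
Proof.
case: k => // k _ kt; rewrite /order_stat /=.
by apply: nth_count_le; rewrite ?sort_le_sorted// count_sort_codom.
Qed.

Lemma order_stat_ge y k t : (0 < k <= N)%N ->
  (\sum_i (y i < t)%R < k)%N -> t <= order_stat y k.
Proof.
case: k => // k /= kN kt; rewrite /order_stat /=; apply: nth_count_ge.
  by rewrite ?sort_le_sorted.
by rewrite count_sort_codom size_sort_codom -ltnS kt kN.
Qed.

Lemma order_stat_gtE y k t : (0 < k <= N)%N ->
  (t < order_stat y k) = (\sum_i (y i <= t)%R < k)%N.
Proof.
move=> kN; apply/idP/idP.
  apply: contraTT; rewrite -leqNgt -leNgt; apply: order_stat_le.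
  by case/andP: kN.
case: k kN => // k /= kN kt; rewrite /order_stat /=; apply: nth_count_gt.
  by rewrite ?sort_le_sorted.
by rewrite count_sort_codom size_sort_codom -ltnS kt kN.
Qed.

Lemma order_stat_homo y k k' : (0 < k)%N -> (k <= k' <= N)%N ->
  order_stat y k <= order_stat y k'.
Proof.
move=> k0 /andP[kk' k'N]; rewrite /order_stat le_sorted_leq_nth ?sort_le_sorted//.
- by rewrite inE size_sort_codom (leq_trans _ k'N)//; case: k k0 kk'.
- by rewrite inE size_sort_codom (leq_trans _ k'N)//; case: k' kk' k'N; case: k k0.
- by case: k k0 kk' => // k _; case: k' k'N.
Qed.

Context d (T : measurableType d).

Lemma measurable_order_stat (Y : 'I_N -> T -> R) k : (0 < k <= N)%N ->
  (forall i, measurable_fun setT (Y i)) ->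
  measurable_fun setT (fun w => order_stat (fun i => Y i w) k).
Proof.
move=> kN mY mT; apply: (measurability _ (RGenOInfty.measurableE R)) => //.
move=> _ [_ [t ->] <-]; rewrite setTI.
pose S w : R := \sum_i \1_[set w | Y i w <= t] w.
have mS : measurable_fun setT S.
  by apply: measurable_sum => i; apply: measurable_indic; exact: measurable_leset.
rewrite (_ : _ @^-1` _ = setT `&` S @^-1` `]-oo, k%:R[).
  by apply: mS => //; exact: measurable_itv.
rewrite setTI; apply/seteqP; split => w /=; rewrite !in_itv/= andbT order_stat_gtE//;
  rewrite /S (eq_bigr _ (fun i _ => indic_boolE _ _ _)) -natr_sum ltr_nat //.
Qed.

Lemma measurable_trimmed_mean (X Y : 'I_N -> T -> R) (eps : R) :
    (0 < N)%N -> (0 < Num.truncn (eps * N%:R) <= N)%N ->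
    (0 < Num.truncn ((1 - eps) * N%:R) <= N)%N ->
    (forall i, measurable_fun setT (X i)) ->
    (forall i, measurable_fun setT (Y i)) ->
  measurable_fun setT
    (fun w => trimmed_mean eps (fun i => X i w) (fun i => Y i w)).
Proof.
move=> N0 k1 k2 mX mY; rewrite /trimmed_mean; apply: measurable_funM => //.
apply: measurable_sum => i; rewrite /phi.
have m1 := measurable_order_stat k1 mY; have m2 := measurable_order_stat k2 mY.
apply: measurable_fun_ifT => //; first exact: measurable_fun_ltr.
by apply: measurable_fun_ifT => //; exact: measurable_fun_ltr.
Qed.

End OrderStatistics.

(** * Effect of the corruption *)
Section Corruption.
Context (R : realType) (N : nat).
Implicit Types (x y xt yt : 'I_N -> R).

(** Each modified entry moves the sum by at most the oscillation of f. *)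
Lemma sum_corrupted x xt (f : R -> R) (l u m : R) :
    (forall t, l <= f t <= u) ->
    #|[set i | xt i != x i]%SET|%:R <= m ->
  \sum_i f (xt i) <= \sum_i f (x i) + m * (u - l).
Proof.
move=> flu xm.
have ul : 0 <= u - l by have /andP[] := flu 0; lra.
apply: (@le_trans _ _ (\sum_i (f (x i) + (xt i != x i)%:R * (u - l)))).
  apply: ler_sum => i _; have /andP[] := flu (xt i); have /andP[] := flu (x i).
  by case: eqVneq => [->|_] /=; lra.
rewrite big_split /= lerD2l -mulr_suml ler_wpM2r//.
by rewrite (le_trans _ xm)// -natr_sum ler_nat -sum1dep_card [leqRHS]big_mkcond.
Qed.

Lemma phi_le_bounds (a b a' b' t : R) :
  a <= b -> a' <= b' -> a <= a' -> b <= b' -> phi a b t <= phi a' b' t.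
Proof.
rewrite /phi => ab ab' aa bb; case: (ltP b t) => ?; case: (ltP b' t) => ?;
  (try (case: ltP => ?)); (try (case: ltP => ?)); lra.
Qed.

(** The two implications are what order statistics provide: alpha lies below any
    level which has more than k of the yt below it, and beta below any level
    exceeded by fewer than k of them.  The margin m in the counts of the y makes
    them survive the corruption; then the truncation points can be replaced by
    a and b before the xt are replaced by the x. *)
Lemma corrupted_clipped_sum_le x y xt yt (alpha beta a b k m : R) :
    alpha <= beta -> a <= b ->
    #|[set i | joint_sample xt yt i != joint_sample x y i]%SET|%:R <= m ->
    k + m < \sum_i (y i <= a)%R%:R ->
    (k < \sum_i (yt i <= a)%R%:R -> alpha <= a) ->
    \sum_i (b < y i)%R%:R < k - m ->
    (\sum_i (b < yt i)%R%:R < k -> beta <= b) ->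
  \sum_i phi alpha beta (xt i) <= \sum_i phi a b (x i) + m * (b - a).
Proof.
move=> ab' ab card ya yta yb ytb.
have cx : #|[set i | xt i != x i]%SET|%:R <= m.
  apply: le_trans card; rewrite ler_nat.
  rewrite -(card_imset _ (@inl_inj 'I_N 'I_N)) subset_leq_card//.
  by apply/fintype.subsetP => _ /imsetP[i + ->]; rewrite !inE.
have cy : #|[set i | yt i != y i]%SET|%:R <= m.
  apply: le_trans card; rewrite ler_nat.
  rewrite -(card_imset _ (@inr_inj 'I_N 'I_N)) subset_leq_card//.
  by apply/fintype.subsetP => _ /imsetP[i + ->]; rewrite !inE.
have alpha_a : alpha <= a.
  apply: yta; have := @sum_corrupted y yt (fun t => - (t <= a)%R%:R) (-1) 0 m.
  rewrite !sumrN => H; have {H} := H _ cy; rewrite opprK add0r mulr1 => H.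
  by suff : - \sum_i (yt i <= a)%R%:R <= - \sum_i (y i <= a)%R%:R + m; [lra|];
    apply: H => t; case: (t <= a); rewrite /=; apply/andP; split; lra.
have beta_b : beta <= b.
  apply: ytb; have := @sum_corrupted y yt (fun t => (b < t)%R%:R) 0 1 m.
  move=> H; have {H} := H _ cy; rewrite subr0 mulr1 => H.
  by suff : \sum_i (b < yt i)%R%:R <= \sum_i (b < y i)%R%:R + m; [lra|];
    apply: H => t; case: (b < t); rewrite /=; apply/andP; split; lra.
apply: (@le_trans _ _ (\sum_i phi a b (xt i))).
  by apply: ler_sum => i _; exact: phi_le_bounds.
by apply: sum_corrupted => // t; rewrite phi_ge_lb// phi_le_ub.
Qed.

End Corruption.

(** * Quantiles of an atomless law *)
Section Quantiles.
Context (R : realType) d (T : measurableType d) (P : probability T R).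
Implicit Types Z : T -> R.

Let cdfE Z (mZ : measurable_fun setT Z) M :
  cdf (mfun_Sub (mem_set mZ) : {RV P >-> R}) M = P [set w | Z w <= M].
Proof.
by rewrite /cdf /distribution /pushforward; congr (P _).
Qed.

Lemma le_cdf_right_limit Z q (c : \bar R) : measurable_fun setT Z ->
    (forall M, q < M -> (c <= P [set w | (Z w <= M)%R])%E) ->
  (c <= P [set w | (Z w <= q)%R])%E.
Proof.
move=> mZ H; rewrite -(cdfE mZ).
apply: cvge_ge (@cdf_right_continuous _ _ _ P (mfun_Sub (mem_set mZ)) q).
near=> M; rewrite cdfE; apply: H; near: M; exact: nbhs_right_gt.
Unshelve. all: by end_near. Qed.

Lemma cdf_small Z (c : R) : measurable_fun setT Z -> 0 < c ->
  exists M, (P [set w | (Z w <= M)%R] < c%:E)%E.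
Proof.
move=> mZ c0; have := @cvg_cdfNy0 _ _ _ P (mfun_Sub (mem_set mZ)).
have cN : nbhs (0 : \bar R)%E [set x | x < c%:E]%E.
  by apply: open_nbhs_nbhs; split; [exact: open_ereal_lt_ereal|rewrite /= lte_fin].
move=> /(_ _ cN) [M [_ HM]]; exists (M - 1).
by rewrite -(cdfE mZ); apply: HM; rewrite gtrBl.
Qed.

Lemma ltset_setC Z M : [set w | Z w < M] = ~` [set w | M <= Z w].
Proof. by apply/seteqP; split => w /=; rewrite ltNge => /negP. Qed.

(** By definition of q as a supremum, P(Z >= M) >= 1 - p for M < q and P(Z < M) > p
    for M > q.  Letting M tend to q, by right continuity of the distribution
    functions of - Z and Z, gives P(Z >= q) >= 1 - p and P(Z <= q) >= p; without
    an atom at q these probabilities add up to 1. *)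
Lemma quantile_level Z p : measurable_fun setT Z ->
    (forall x, P [set w | Z w = x] = 0) -> 0 < p -> p < 1 ->
  P [set w | Z w <= quantile P Z p] = p%:E /\
  P [set w | quantile P Z p <= Z w] = (1 - p)%:E.
Proof.
move=> mZ atomless p0 p1; set q := quantile P Z p.
pose S := [set M : R | ((1 - p)%:E <= P [set w | (M <= Z w)%R])%E].
have mge M := measurable_geset M mZ; have mle M := measurable_leset M mZ.
have mN : measurable_fun setT (- Z) by exact: measurable_funN.
have geN M : [set w | (- Z) w <= - M] = [set w | M <= Z w].
  by apply/seteqP; split => w /=; rewrite fctE lerN2.
have mlt M : measurable [set w | Z w < M] by rewrite ltset_setC; exact: measurableC.
have anti M M' : M <= M' -> (P [set w | (M' <= Z w)%R] <= P [set w | (M <= Z w)%R])%E.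
  move=> MM'; apply: le_measure; rewrite ?inE//.
  by move=> w /=; exact: le_trans.
have Plt M : P [set w | Z w < M] = (1 - P [set w | (M <= Z w)%R])%E.
  by rewrite ltset_setC probability_setC.
have Ple M : P [set w | Z w <= M] = P [set w | Z w < M].
  rewrite (_ : [set w | Z w <= M] = [set w | Z w < M] `|` [set w | Z w = M]).
    have mE : measurable [set w | Z w = M].
      rewrite (_ : [set w | Z w = M] = [set w | Z w <= M] `&` [set w | M <= Z w]).
        exact: measurableI.
      apply/seteqP; split => w /=; first by move->.
      by move=> [? ?]; apply/eqP; rewrite eq_le; apply/andP.
    rewrite measureU//; first by rewrite [X in (_ + X)%E](atomless M) adde0.
    by apply/seteqP; split => // w /= [+ E]; rewrite E ltxx.
  apply/seteqP; split => w /=.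
    by rewrite le_eqVlt => /orP[/eqP|]; [right|left].
  by case=> [/ltW|->].
have Sub : has_ubound S.
  have [M HM] := cdf_small mN (c := 1 - p) ltac:(by rewrite subr_gt0).
  exists (- M) => x Sx; rewrite leNgt; apply/negP => Mx.
  move: HM; rewrite -(opprK M) geN => HM.
  by have := le_lt_trans (le_trans Sx (anti _ _ (ltW Mx))) HM; rewrite ltxx.
have S0 : S !=set0.
  have [M HM] := cdf_small mZ p0.
  exists M; rewrite /S /=; move: HM; rewrite Ple Plt.
  rewrite -(fineK (fin_num_measure P _ (mge M))); set r := fine _.
  by rewrite -EFinB lte_fin lee_fin; lra.
have Pge : ((1 - p)%:E <= P [set w | (q <= Z w)%R])%E.
  rewrite -(geN q); apply: le_cdf_right_limit => // M qM.
  rewrite -(opprK M) geN.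
  have [y Sy qy] := @sup_gt _ S (- M) S0 ltac:(rewrite ltrNl//).
  exact: le_trans Sy (anti _ _ (ltW qy)).
have Ple_ge : (p%:E <= P [set w | (Z w <= q)%R])%E.
  apply: le_cdf_right_limit => // M qM.
  have : ~ S M by move=> SM; have := ub_le_sup Sub SM; rewrite leNgt => /negP; exact.
  rewrite /S /= Ple Plt => /negP; rewrite -ltNge.
  rewrite -(fineK (fin_num_measure P _ (mge M))); set r := fine _.
  by rewrite -EFinB lte_fin lee_fin; lra.
move: Ple_ge Pge; rewrite Ple Plt.
rewrite -(fineK (fin_num_measure P _ (mge q))); set r := fine _.
by rewrite -EFinB !lee_fin => h1 h2; split; congr EFin; lra.
Qed.

End Quantiles.

(** * Estimates of the deviation radius *)
Section DeviationArithmetic.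
Context (R : realType).
Implicit Types (eps eta tau sigma a b S H E m r : R).

(** Let A = p a + S and B = H - theta b be the means of (a - Z)^+ and (Z - b)^+.
    With c = 2 tau^2 + 2 eta, which is at most theta, the left-hand side is at
    most A + c b - 2 eta a + 2 sigma tau, and c b is at most the maximum of H
    and 0.  If a <= 0, then A - 2 eta a <= S because 2 eta <= p.  If a > 0, the
    tail of mass 2 eps contains the whole negative part of Z, whose mean is m, and
    the values between a and the quantile of order 2 eps, so it exceeds m by
    a (2 eps - p); with a (1 - p) <= m and p <= (1 + 6 eps) / 5 this yields
    A + H <= 3 E. *)
Lemma deviation_le_tail eps eta tau sigma a b S H E m
    (p := 2 * eps - 4 / 5 * eps ^+ 2) (theta := eps / 4)
    (e := p * a + S - (H - theta * b)) :
    0 < eps -> eps <= 1 / 2 -> 0 <= eta -> 12 * tau ^+ 2 = eps - 8 * eta ->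
    0 <= p * a + S -> 0 <= H - theta * b -> a <= b -> 0 <= E ->
    a * (1 - p) <= S -> S <= E -> H <= E -> S <= m -> H <= m ->
    (0 < a -> m + a * (2 * eps - p) <= E) ->
  e + 2 * sigma * tau + 2 * (b - e) * tau ^+ 2 + 2 * eta * (b - a)
  <= 3 * E + 2 * sigma * tau.
Proof.
move=> e0 e1 eta0 tauE A0 B0 ab E0 aS SE HE Sm Hm aE.
have tau20 : 0 <= tau ^+ 2 by exact: sqr_ge0.
have t2 : tau ^+ 2 = (eps - 8 * eta) / 12 by lra.
have pE : p = 2 * eps - 4 / 5 * eps ^+ 2 by [].
have pe : eps <= p by have := ler_wpM2l (ltW e0) e1; rewrite pE expr2; lra.
have thE : theta = eps / 4 by [].
have eE : e = (p * a + S) - (H - theta * b) by [].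
have [A AE] : exists A, A = p * a + S by eexists.
have [B BE] : exists B, B = H - theta * b by eexists.
rewrite -AE in A0 eE; rewrite -BE in B0 eE; rewrite eE.
pose c := 2 * tau ^+ 2 + 2 * eta.
have cth : c <= theta by rewrite /c; lra.
have c0 : 0 <= c by rewrite /c; lra.
have B1 : 0 <= B * (1 - 2 * tau ^+ 2) by rewrite mulr_ge0//; lra.
have A1 : 0 <= A * tau ^+ 2 by rewrite mulr_ge0.
have red : A - B + 2 * sigma * tau + 2 * (b - (A - B)) * tau ^+ 2 + 2 * eta * (b - a)
    = A + c * b - 2 * eta * a + 2 * sigma * tau - B * (1 - 2 * tau ^+ 2)
      - 2 * (A * tau ^+ 2).
  by rewrite /c; ring.
suff : A + c * b - 2 * eta * a <= 3 * E by rewrite red; lra.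
have cb : c * b <= H \/ c * b <= 0.
  have [b0|b0] := leP 0 b; [left|right].
    by have := ler_wpM2r b0 cth; lra.
  by rewrite mulr_ge0_le0// ltW.
have cbE : c * b <= E by case: cb; lra.
have [a0|a0] := leP a 0.
  have : 2 * eta * (- a) <= p * (- a).
    by rewrite ler_wpM2r ?oppr_ge0//; lra.
  by lra.
have {cb}cb : c * b <= m.
  have b0 : 0 <= b by lra.
  by have := ler_wpM2r b0 cth; lra.
have eta_a : 0 <= eta * a by rewrite mulr_ge0// ltW.
have {}aE := aE a0.
have key : 0 <= a * (1 + 6 * eps - 5 * p).
  rewrite mulr_ge0 ?(ltW a0)// pE.
  have : 0 <= (1 - 2 * eps) ^+ 2 by exact: sqr_ge0.
  by rewrite !expr2; lra.
by lra.
Qed.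

Lemma ler_of_sqr (x y : R) : 0 <= y -> x ^+ 2 <= y ^+ 2 -> x <= y.
Proof.
move=> y0 xy; rewrite leNgt; apply/negP => yx.
by move: xy; rewrite leNgt ltrXn2r// ?nnegrE//; rewrite (le_trans y0)// ltW.
Qed.

(** In units of sqrt eps * sigma: S is at most sqrt 2, H at most 1/2 and sigma tau
    at most 1 / sqrt 12, while p a <= 4 S when a > 0 since p <= 4/5. *)
Lemma deviation_le_sigma eps eta tau sigma a b S H r
    (p := 2 * eps - 4 / 5 * eps ^+ 2) (theta := eps / 4)
    (e := p * a + S - (H - theta * b)) :
    0 < eps -> eps <= 1 / 2 -> 0 <= eta -> 8 * eta <= eps ->
    0 <= tau -> 12 * tau ^+ 2 = eps -> 0 <= r -> r ^+ 2 = eps ->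
    0 <= sigma ->
    0 <= p * a + S -> 0 <= H - theta * b -> a <= b ->
    a * (1 - p) <= S -> S ^+ 2 <= sigma ^+ 2 * p -> H ^+ 2 <= sigma ^+ 2 * theta ->
  e + 2 * sigma * tau + 2 * (b - e) * tau ^+ 2 + 2 * eta * (b - a)
  <= 10 * r * sigma.
Proof.
move=> e0 e1 eta0 eta1 tau0 tauE r0 rE sg0 A0 B0 ab aS S2 H2.
have t2 : tau ^+ 2 = eps / 12 by lra.
have pE : p = 2 * eps - 4 / 5 * eps ^+ 2 by [].
have thE : theta = eps / 4 by [].
have eE : e = (p * a + S) - (H - theta * b) by [].
have p2 : p <= 2 * eps by have := sqr_ge0 eps; lra.
have pe : eps <= p by have := ler_wpM2l (ltW e0) e1; rewrite pE expr2; lra.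
have p45 : p <= 4 / 5 by apply: lower_level_le => //; exact: ltW.
set g := r * sigma; have g0 : 0 <= g by rewrite mulr_ge0.
have sg20 : 0 <= sigma ^+ 2 by exact: sqr_ge0.
(* 71/50 and 29/100 are rational upper bounds for sqrt 2 and 1 / sqrt 12. *)
have Sg : S <= 71 / 50 * g.
  apply: ler_of_sqr; first lra.
  apply: (le_trans S2); rewrite /g !exprMn rE.
  have := ler_wpM2l sg20 p2; have : 0 <= eps * sigma ^+ 2 by rewrite mulr_ge0// ltW.
  by lra.
have Hg : H <= 1 / 2 * g.
  by apply: ler_of_sqr; [lra|]; rewrite (le_trans H2)// /g !exprMn rE thE; lra.
have tg : sigma * tau <= 29 / 100 * g.
  suff : tau <= 29 / 100 * r by move/(ler_wpM2l sg0); rewrite /g; lra.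
  by apply: ler_of_sqr; [lra|]; rewrite exprMn rE t2; lra.
have [A AE] : exists A, A = p * a + S by eexists.
have [B BE] : exists B, B = H - theta * b by eexists.
rewrite -AE in A0 eE; rewrite -BE in B0 eE; rewrite eE.
pose c := 2 * tau ^+ 2 + 2 * eta.
have cth : c <= 5 / 3 * theta by rewrite /c; lra.
have c0 : 0 <= c by rewrite /c; lra.
have B1 : 0 <= B * (1 - 2 * tau ^+ 2) by rewrite mulr_ge0//; lra.
have A1 : 0 <= A * tau ^+ 2 by rewrite mulr_ge0// sqr_ge0.
have red : A - B + 2 * sigma * tau + 2 * (b - (A - B)) * tau ^+ 2 + 2 * eta * (b - a)
    = A + c * b - 2 * eta * a + 2 * (sigma * tau) - B * (1 - 2 * tau ^+ 2)
      - 2 * (A * tau ^+ 2).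
  by rewrite /c; ring.
have -> : 10 * r * sigma = 10 * g by rewrite /g; ring.
suff : A + c * b - 2 * eta * a <= 9 * g by rewrite red; lra.
have cb : c * b <= 5 / 6 * g.
  have [b0|b0] := leP 0 b; first by have := ler_wpM2r b0 cth; lra.
  have : c * b <= 0 by rewrite mulr_ge0_le0// ltW.
  by lra.
have [a0|a0] := leP a 0.
  have : 2 * eta * (- a) <= p * (- a) by rewrite ler_wpM2r ?oppr_ge0//; lra.
  have : p * a <= 0 by rewrite mulr_ge0_le0//; lra.
  by lra.
have eta_a : 0 <= eta * a by rewrite mulr_ge0// ltW.
have : a * (1 / 5) <= a * (1 - p) by rewrite ler_wpM2l ?(ltW a0)//; lra.
have : p * a <= 4 / 5 * a by rewrite ler_wpM2r ?(ltW a0).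
by lra.
Qed.

End DeviationArithmetic.

Section TailComparison.
Context (R : realType) d (T : measurableType d) (Q : probability T R).
Context (Z : T -> R).
Hypothesis mZ : measurable_fun setT Z.
Hypothesis iZ : Q.-integrable [set: T] (EFin \o Z).
Hypothesis Z0 : \int[Q]_w Z w = 0.
Context (a b p theta : R).
Hypothesis Qa : Q [set w | Z w <= a] = p%:E.
Hypothesis Qb : Q [set w | b < Z w] = theta%:E.

Local Notation Ex f := (\int[Q]_w f w)%R.
Local Notation L1 f := (Q.-integrable [set: T] (EFin \o f)).
Let A := [set w | Z w <= a].
Let B := [set w | b < Z w].
Let mA : measurable A. Proof. exact: measurable_leset. Qed.
Let mB : measurable B. Proof. exact: measurable_ltset. Qed.
Let iZA : L1 (fun w => Z w * \1_A w). Proof. exact: integrable_mul_indic. Qed.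
Let iZB : L1 (fun w => Z w * \1_B w). Proof. exact: integrable_mul_indic. Qed.
Let AE w : \1_A w = (Z w <= a)%R%:R :> R. Proof. exact: indic_boolE. Qed.
Let BE w : \1_B w = (b < Z w)%R%:R :> R. Proof. exact: indic_boolE. Qed.

Lemma integrable_normr : L1 (fun w => `|Z w|).
Proof. by have := integrable_abse iZ. Qed.

Local Notation S := (lower_mass Q Z a).
Local Notation H := (upper_mass Q Z b).

Lemma lower_level_lt c q : Q [set w | Z w <= c] = q%:E -> p < q -> a < c.
Proof.
move=> Qc pq; rewrite ltNge; apply/negP => ca.
have : (Q [set w | (Z w <= c)%R] <= Q [set w | (Z w <= a)%R])%E.
  apply: le_measure; rewrite ?inE; [exact: measurable_leset..|].
  by move=> w /= /le_trans; apply.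
by rewrite Qc Qa lee_fin leNgt pq.
Qed.

Lemma upper_level_gt c q : Q [set w | c <= Z w] = q%:E -> theta < q -> c <= b.
Proof.
move=> Qc pq; rewrite leNgt; apply/negP => ca.
have : (Q [set w | (c <= Z w)%R] <= Q [set w | (b < Z w)%R])%E.
  apply: le_measure; rewrite ?inE.
  - exact: measurable_geset.
  - exact: measurable_ltset.
  - by move=> w /=; exact: lt_le_trans.
by rewrite Qc Qb lee_fin leNgt pq.
Qed.

Lemma levels_lt : p + theta < 1 -> a < b.
Proof.
move=> pt; apply: (@lower_level_lt _ (1 - theta)); last lra.
rewrite (_ : [set w | Z w <= b] = ~` [set w | b < Z w]); last first.
  by apply/seteqP; split => w /=; rewrite leNgt => /negP.
by rewrite probability_setC// Qb.
Qed.

Let pos w := Num.max (Z w) 0.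

Let posE w : pos w = 2^-1 * `|Z w| + 2^-1 * Z w.
Proof.
rewrite /pos; case: (ltP (Z w) 0) => h; first by rewrite ltr0_norm//; lra.
by rewrite ger0_norm//; lra.
Qed.

Let ipos : L1 pos.
Proof.
rewrite (_ : pos = fun w => 2^-1 * `|Z w| + 2^-1 * Z w); last exact/funext.
apply: integrableD_EFin; apply: integrableZ_EFin => //; exact: integrable_normr.
Qed.

Lemma lower_mass_le_positive_part : S <= Ex pos.
Proof.
have := @Rintegral_lincomb_ge0 _ _ _ Q 0 1 (-1) 1 _ _ _ ipos iZ iZA.
rewrite Z0 => H0; suff: 0 <= 0 + 1 * Ex pos + -1 * 0 + 1 * - S by lra.
rewrite opprK; apply: H0 => w.
by rewrite AE /pos; case: (leP (Z w) a) => ? /=; case: (ltP (Z w) 0) => ?; lra.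
Qed.

Lemma upper_mass_le_positive_part : H <= Ex pos.
Proof.
have := @Rintegral_lincomb_ge0 _ _ _ Q 0 1 (-1) 0 _ _ _ ipos iZB iZB.
rewrite mul0r => H0; suff: 0 <= 0 + 1 * Ex pos + -1 * H + 0 by lra.
apply: H0 => w.
by rewrite BE /pos; case: (ltP b (Z w)) => ? /=; case: (ltP (Z w) 0) => ?; lra.
Qed.

Section LowerTail.
Context (c q : R).
Hypothesis Qc : Q [set w | Z w <= c] = q%:E.
Hypothesis ac : a <= c.
Let C := [set w | Z w <= c].
Let mC : measurable C. Proof. exact: measurable_leset. Qed.
Let CE w : \1_C w = (Z w <= c)%R%:R :> R. Proof. exact: indic_boolE. Qed.
Let iNC : L1 (fun w => `|Z w| * \1_C w).
Proof. by apply: integrable_mul_indic => //; exact: integrable_normr. Qed.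

Lemma lower_mass_le_tail : S <= Ex (fun w => `|Z w| * \1_C w).
Proof.
have := @Rintegral_lincomb_ge0 _ _ _ Q 0 1 1 0 _ _ _ iNC iZA iZA.
rewrite mul0r => H0; suff: 0 <= 0 + 1 * Ex (fun w => `|Z w| * \1_C w) + 1 * - S + 0 by lra.
rewrite opprK; apply: H0 => w; rewrite AE CE; have ac' := ac.
have := ler_norm (- Z w); rewrite normrN.
by have := normr_ge0 (Z w); case: (leP (Z w) a) => ? /=; case: (leP (Z w) c) => ? /=; lra.
Qed.

(** For a > 0 the event Z <= c contains the event Z < 0, on which |Z| integrates to
    the mean of Z^+, and the event a < Z <= c, of mass q - p, on which |Z| > a. *)
Lemma positive_part_le_tail : 0 < a ->
  Ex pos + a * (q - p) <= Ex (fun w => `|Z w| * \1_C w).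
Proof.
move=> a0; have iA := integrable_indic Q mA; have iC := integrable_indic Q mC.
have := Rintegral_lincomb 0 1 (-1) 1 (- a) a iNC ipos iZ iC iA.
rewrite !Rintegral_indic// Qa Qc Z0 /= => E0.
suff : 0 <= 0 + 1 * Ex (fun w => `|Z w| * \1_C w) + -1 * Ex pos + 1 * 0
  + - a * q + a * p by lra.
rewrite -E0; apply: Rintegral_ge0 => w _; rewrite AE CE posE; have ac' := ac.
case: (leP (Z w) a) => ? /=; case: (leP (Z w) c) => ? /=;
  case: (ltrP (Z w) 0) => h; rewrite ?(ltr0_norm h) ?(ger0_norm h); lra.
Qed.

End LowerTail.

Lemma upper_mass_le_tail c : c <= b ->
  H <= Ex (fun w => `|Z w| * \1_[set w | c <= Z w] w).
Proof.
move=> cb; have mC := measurable_geset c mZ.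
have iNC : L1 (fun w => `|Z w| * \1_[set w | c <= Z w] w).
  by apply: integrable_mul_indic => //; exact: integrable_normr.
have := @Rintegral_lincomb_ge0 _ _ _ Q 0 1 (-1) 0 _ _ _ iNC iZB iZB.
rewrite mul0r => H0; suff: 0 <= 0 + 1 * Ex (fun w => `|Z w| * \1_[set w | c <= Z w] w)
  + -1 * H + 0 by lra.
apply: H0 => w; rewrite BE indic_boolE.
have := ler_norm (Z w).
by have := normr_ge0 (Z w); case: (ltP b (Z w)) => ? /=; case: (leP c (Z w)) => ? /=; lra.
Qed.

End TailComparison.

(** * Deviation on one side *)
Section OneSided.
Context (R : realType).
Context d0 (T0 : measurableType d0) (P0 : probability T0 R) (X0 : {RV P0 >-> R}).
Context d (T : measurableType d) (P : probability T R).
Context (N : nat) (X Y : 'I_N -> {RV P >-> R}).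
Hypothesis N_gt0 : (0 < N)%N.
Hypothesis copies : forall k, identically_distributed (joint_sample X Y k) X0.
Hypothesis indep : mutually_independent (joint_sample X Y).
Context (h : R -> R) (mh : measurable_fun setT h).
Context (eps eta L sigma : R).
Hypothesis eps_gt0 : 0 < eps.
Hypothesis eps_lt : eps < 1 / 2.
Hypothesis eta_ge0 : 0 <= eta.
Hypothesis L_ge0 : 0 <= L.
Hypothesis expL : expR (- L) <= 1 / 4.
Hypothesis epsNE : eps * N%:R = 8 * eta * N%:R + 12 * L.

Let Z w := h (X0 w).
Let p := 2 * eps - 4 / 5 * eps ^+ 2.
Let theta := eps / 4.
Let mZ : measurable_fun setT Z. Proof. exact: measurableT_comp. Qed.

Hypothesis iZ : P0.-integrable [set: T0] (EFin \o Z).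
Hypothesis Z0 : \int[P0]_w Z w = 0.
Hypothesis iZ2 : P0.-integrable [set: T0] (EFin \o (fun w => Z w ^+ 2)).
Hypothesis Z2 : \int[P0]_w (Z w ^+ 2) = sigma ^+ 2.
Hypothesis sigma_ge0 : 0 <= sigma.
Hypothesis atomless : forall x, P0 [set w | Z w = x] = 0.

Let eps_ge0 : 0 <= eps. Proof. exact: ltW. Qed.
Let eps_le : eps <= 1 / 2. Proof. exact: ltW. Qed.

Section Event.
Context (a b : R).
Hypothesis Qa : P0 [set w | Z w <= a] = p%:E.
Hypothesis Qb : P0 [set w | b < Z w] = theta%:E.

Local Notation S := (lower_mass P0 Z a).
Local Notation H := (upper_mass P0 Z b).
Local Notation e := (clipped_mean P0 Z a b p theta).

(** The clipped mean, the two terms of Bernstein's inequality, and the largest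
    effect of the corrupted arguments. *)
Definition deviation_radius (tau : R) :=
  e + 2 * sigma * tau + 2 * (b - e) * tau ^+ 2 + 2 * eta * (b - a).

Lemma lower_lt_upper_level : a < b.
Proof.
apply: (levels_lt mZ Qa Qb); have := lower_level_le eps_ge0 eps_le.
by have := eps_lt; rewrite /p /theta; lra.
Qed.

(** If sigma = 0, both truncated moments vanish, which forces b <= 0 <= a. *)
Lemma sigma_gt0 : 0 < sigma.
Proof.
have ab := lower_lt_upper_level.
rewrite lt_neqAle sigma_ge0 andbT eq_sym; apply/eqP => s0.
have := sqr_lower_mass_le mZ iZ iZ2 Z2 Qa.
have := sqr_upper_mass_le mZ iZ iZ2 Z2 Qb.
rewrite s0 expr0n /= !mul0r => /(conj (sqr_ge0 H))/andP/le_anti/esym/eqP.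
rewrite sqrf_eq0 => /eqP H0.
move=> /(conj (sqr_ge0 S))/andP/le_anti/esym/eqP; rewrite sqrf_eq0 => /eqP S0.
have := lower_excess_ge0 mZ iZ Qa; have := upper_excess_ge0 mZ iZ Qb.
rewrite S0 H0 addr0 sub0r oppr_ge0 => b0 a0.
have th0 : 0 < theta by rewrite /theta; have := eps_gt0; lra.
have p0 : 0 < p.
  have := ler_wpM2l eps_ge0 eps_le; rewrite /p expr2; have := eps_gt0; lra.
move: a0 b0; rewrite pmulr_rge0// pmulr_rle0// => a0 b0; lra.
Qed.

Lemma one_sided_event tau : 0 < tau -> 12 * tau ^+ 2 <= eps ->
  exists G : set T, [/\ measurable G,
    (P (~` G) <= (2 * expR (- (N%:R * tau ^+ 2)))%:E)%E &
    forall w, G w -> [/\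
      5 / 4 * (eps * N%:R) - 3 * L < \sum_i (h (Y i w) <= a)%R%:R,
      \sum_i (b < h (Y i w))%R%:R < 3 / 4 * (eps * N%:R) + 3 * L &
      \sum_i phi a b (h (X i w)) <=
        N%:R * (e + 2 * sigma * tau + 2 * (b - e) * tau ^+ 2)]].
Proof.
move=> tau_gt0 tau_eps.
have indX : mutually_independent X := mutually_independent_inj (@inl_inj _ _) indep.
have indY : mutually_independent Y := mutually_independent_inj (@inr_inj _ _) indep.
have idX i : identically_distributed (X i) X0 := copies (inl i).
have idY i : identically_distributed (Y i) X0 := copies (inr i).
have t1 := few_below_tail indY idY mh L eps_ge0 eps_le Qa.
have t2 := many_above_tail indY idY mh eps_ge0 L_ge0 Qb.
have t3 := clipped_sum_tail indX idX mh Qa Qb iZ Z0 iZ2 Z2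
  (ltW lower_lt_upper_level) sigma_gt0 tau_gt0.
move: t1 t2 t3; set T1 := [set w | _]; set T2 := [set w | _]; set T3 := [set w | _].
move=> t1 t2 t3.
have mU (V : 'I_N -> {RV P >-> R}) (f : R -> R) : measurable_fun setT f ->
    measurable_fun setT (fun w => \sum_i f (V i w)).
  by move=> mf; apply: measurable_sum => i; exact: measurableT_comp.
have m1 : measurable T1.
  apply: measurable_leset; apply: (mU Y (fun x => (h x <= a)%R%:R)).
  apply: (measurable_fun_bool (Z := h) (A := fun x => x <= a)).
  exact: measurable_leset.
have m2 : measurable T2.
  apply: measurable_geset; apply: (mU Y (fun x => (b < h x)%R%:R)).
  apply: (measurable_fun_bool (Z := h) (A := fun x => b < x)).
  exact: measurable_ltset.
have m3 : measurable T3.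
  apply: measurable_geset; apply: (mU X (fun x => phi a b (h x))).
  by apply: measurable_clipped => //; exact/ltW/lower_lt_upper_level.
exists (~` (T1 `|` T2 `|` T3)); split.
- by apply: measurableC; apply: measurableU => //; exact: measurableU.
- rewrite setCK.
  have U1 := measureU2 P (measurableU _ _ m1 m2) m3.
  have U2 := measureU2 P m1 m2.
  apply: (le_trans U1); apply: (le_trans (leeD U2 (lexx _))).
  apply: (le_trans (leeD (leeD t1 t2) t3)).
  rewrite -!EFinD lee_fin.
  set x := expR (- (N%:R * _)).
  suff : expR (- (eps * N%:R / 12) - 3 / 2 * L) <= x * (1 / 4).
    have : 0 <= x by exact: expR_ge0.
    by lra.
  rewrite expRD ler_pM ?expR_ge0//.
    rewrite ler_expR lerN2; have := ler_wpM2l (ler0n R N) tau_eps; lra.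
  by rewrite (le_trans _ expL)// ler_expR; have := L_ge0; lra.
- move=> w nT; split.
  + by rewrite ltNge; apply/negP => H1; apply: nT; left; left.
  + by rewrite ltNge; apply/negP => H2; apply: nT; left; right.
  + by rewrite leNgt; apply/negP => /ltW H3; apply: nT; right.
Qed.

Lemma one_sided_deviation tau : 0 < tau -> 12 * tau ^+ 2 <= eps ->
  exists G : set T, [/\ measurable G,
    (P (~` G) <= (2 * expR (- (N%:R * tau ^+ 2)))%:E)%E &
    forall w, G w -> forall (xt yt : 'I_N -> R) alpha beta,
      alpha <= beta ->
      #|[set i | joint_sample xt yt i !=
         joint_sample (fun i => h (X i w)) (fun i => h (Y i w)) i]%SET|%:R
        <= 2 * eta * N%:R ->
      (eps * N%:R < \sum_i (yt i <= a)%R%:R -> alpha <= a) ->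
      (\sum_i (b < yt i)%R%:R < eps * N%:R -> beta <= b) ->
      N%:R^-1 * (\sum_i phi alpha beta (xt i)) <= deviation_radius tau].
Proof.
move=> t0 te; have [G [mG PG HG]] := one_sided_event t0 te.
exists G; split => // w /HG [h1 h2 h3] xt yt alpha beta ab' card ha hb.
have N0 : 0 < N%:R :> R by rewrite ltr0n.
rewrite mulrC ler_pdivrMr//.
have epsNE' := epsNE.
have := @corrupted_clipped_sum_le _ _ (fun i => h (X i w)) (fun i => h (Y i w)) xt yt
  alpha beta a b (eps * N%:R) (2 * eta * N%:R) ab' (ltW lower_lt_upper_level) card _ ha _ hb.
move=> /(_ _ _)/le_trans; apply; [lra..|].
rewrite /deviation_radius; lra.
Qed.

Lemma deviation_tail_bound tau lo hi E :
    0 <= tau -> 12 * tau ^+ 2 = eps - 8 * eta ->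
    P0 [set w | Z w <= lo] = (2 * eps)%:E ->
    P0 [set w | hi <= Z w] = (2 * eps)%:E ->
    \int[P0]_w (`|Z w| * \1_[set w | Z w <= lo] w) <= E ->
    \int[P0]_w (`|Z w| * \1_[set w | hi <= Z w] w) <= E ->
  deviation_radius tau <= 3 * E + 2 * sigma * tau.
Proof.
move=> tau0 tauE Qlo Qhi loE hiE.
have a_lo : a <= lo.
  apply/ltW/(lower_level_lt mZ Qa Qlo).
  have : 0 < eps ^+ 2 by rewrite exprn_gt0.
  by rewrite /p; lra.
have hi_b : hi <= b.
  by apply: (upper_level_gt mZ Qb Qhi); have := eps_gt0; rewrite /theta; lra.
have E0 : 0 <= E by apply: le_trans loE; apply: Rintegral_ge0 => w _; rewrite mulr_ge0.
apply: (@deviation_le_tail R eps eta tau sigma a b S H E (\int[P0]_w Num.max (Z w) 0)) => //.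
- exact: lower_excess_ge0.
- exact: upper_excess_ge0.
- exact/ltW/lower_lt_upper_level.
- exact: level_le_lower_mass.
- by apply: le_trans loE; exact: lower_mass_le_tail.
- by apply: le_trans hiE; exact: upper_mass_le_tail.
- exact: lower_mass_le_positive_part.
- exact: upper_mass_le_positive_part.
- by move=> a0; apply: le_trans loE; exact: positive_part_le_tail.
Qed.

Lemma deviation_stddev_bound tau :
    8 * eta <= eps -> 0 <= tau -> 12 * tau ^+ 2 = eps ->
  deviation_radius tau <= 10 * Num.sqrt eps * sigma.
Proof.
move=> eta_eps tau0 tauE.
apply: deviation_le_sigma => //.
- exact: sqr_sqrtr.
- exact: lower_excess_ge0.
- exact: upper_excess_ge0.
- exact/ltW/lower_lt_upper_level.
- exact: level_le_lower_mass.
- exact: sqr_lower_mass_le.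
- exact: sqr_upper_mass_le.
Qed.

End Event.

(** The truncation points enter only through the two implications, which the
    order statistics satisfy as well as their opposites do for the reflected
    sample; this lets one statement serve both signs. *)
Lemma one_sided_bound tau bound : 0 < tau -> 12 * tau ^+ 2 <= eps ->
    (forall a b, P0 [set w | Z w <= a] = p%:E ->
       P0 [set w | b < Z w] = theta%:E -> deviation_radius a b tau <= bound) ->
  exists G : set T, [/\ measurable G,
    (P (~` G) <= (2 * expR (- (N%:R * tau ^+ 2)))%:E)%E &
    forall w, G w -> forall (xt yt : 'I_N -> R) alpha beta,
      alpha <= beta ->
      #|[set i | joint_sample xt yt i !=
         joint_sample (fun i => h (X i w)) (fun i => h (Y i w)) i]%SET|%:R
        <= 2 * eta * N%:R ->
      (forall t, eps * N%:R < \sum_i (yt i <= t)%R%:R -> alpha <= t) ->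
      (forall t, \sum_i (t < yt i)%R%:R < eps * N%:R -> beta <= t) ->
      N%:R^-1 * (\sum_i phi alpha beta (xt i)) <= bound].
Proof.
move=> tau0 tau_eps Hbound.
have p0 : 0 < p.
  by have := ler_wpM2l eps_ge0 eps_le; rewrite /p expr2; have := eps_gt0; lra.
have p1 : p < 1 by have := lower_level_le eps_ge0 eps_le; rewrite /p; lra.
have th0 : 0 < 1 - theta by rewrite /theta; have := eps_lt; lra.
have th1 : 1 - theta < 1 by rewrite /theta; have := eps_gt0; lra.
have [Qa _] := quantile_level mZ atomless p0 p1.
have [Qb _] := quantile_level mZ atomless th0 th1.
set a := quantile _ _ _ in Qa; set b := quantile _ _ _ in Qb.
have {}Qb : P0 [set w | b < Z w] = theta%:E.
  rewrite (_ : [set w | b < Z w] = ~` [set w | Z w <= b]); last first.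
    by apply/seteqP; split => w /=; rewrite ltNge => /negP.
  rewrite probability_setC; last exact: measurable_leset.
  by rewrite Qb -EFinB; congr EFin; ring.
have [G [mG PG HG]] := one_sided_deviation Qa Qb tau0 tau_eps.
exists G; split => // w Gw xt yt alpha beta ab card ha hb.
apply: le_trans (Hbound a b Qa Qb).
exact: (HG w Gw xt yt alpha beta ab card (ha a) (hb b)).
Qed.

End OneSided.

(** * Centering and reflection *)
Section AffineChanges.
Context (R : realType).
Implicit Types a b x c : R.

Lemma phi_shift a b x c : phi (a - c) (b - c) (x - c) = phi a b x - c.
Proof. by rewrite /phi !ltrD2r; case: ltP => // _; case: ltP. Qed.

Lemma phi_opp a b x : a <= b -> phi (- b) (- a) (- x) = - phi a b x.
Proof.
move=> ab; rewrite /phi !ltrN2; case: (ltP x a) => xa; case: (ltP b x) => bx //.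
by have := lt_le_trans (lt_trans bx xa) ab; rewrite ltxx.
Qed.

End AffineChanges.

Section CenteredVariable.
Context (R : realType).
Context d (T : measurableType d) (P : probability T R) (X : {RV P >-> R}).
Hypothesis X_ac : absolutely_continuous X.
Hypothesis X_int : P.-integrable setT (EFin \o X).
Hypothesis X_var : ('V_P[X] < +oo)%E.

Let Z : T -> R := centered P X.
Local Notation mu := (mean P X).

Lemma integrable_centered : P.-integrable setT (EFin \o Z).
Proof.
have := integrableD_EFin X_int (integrable_cst_EFin P (- mu)).
by apply: eq_integrable.
Qed.

Lemma measurable_centered : measurable_fun setT Z.
Proof. by apply/measurable_EFinP; case/integrableP: integrable_centered. Qed.

Lemma mean_centered : \int[P]_w Z w = 0.
Proof.
rewrite /Z /centered RintegralB//; last exact: integrable_cst_EFin.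
rewrite Rintegral_cst// (_ : fine (_ setT) = 1); last first.
  by rewrite -[RHS]/(fine 1%:E) -(probability_setT P).
by rewrite mulr1 /mean expectation.unlock /Rintegral subrr.
Qed.

Let varianceE : ('V_P[X] = \int[P]_w ((Z w) ^+ 2)%:E)%E.
Proof.
rewrite /variance covariance.unlock expectation.unlock; apply: eq_integral => w _.
by rewrite /Z /centered /mean expectation.unlock expr2.
Qed.

Lemma integrable_centered_sqr : P.-integrable setT (EFin \o (fun w => Z w ^+ 2)).
Proof.
apply/integrableP; split.
  by apply/measurable_EFinP; apply: measurable_funX; exact: measurable_centered.
rewrite (eq_integral (fun w => ((Z w) ^+ 2)%:E)); last first.
  move=> w _.
  by rewrite /= ger0_norm// sqr_ge0.
by rewrite -varianceE.
Qed.

Lemma second_moment_centered : \int[P]_w (Z w ^+ 2) = stddev P X ^+ 2.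
Proof.
rewrite /stddev sqr_sqrtr; last by rewrite fine_ge0// variance_ge0.
by rewrite /Rintegral varianceE.
Qed.

Lemma atomless_centered x : P [set w | Z w = x] = 0.
Proof.
have m1 : measurable ([set x + mu] : set R) by exact: measurable_set1.
have null1 : (@lebesgue_measure R).-null_set [set x + mu].
  by apply/measure0_null_setP => //; exact: lebesgue_measure_set1.
have := X_ac null1; move=> /(_ [set x + mu] m1 (fun _ => id)).
rewrite /distribution /pushforward => <-; congr (P _).
apply/seteqP; split => w; rewrite /Z /centered /=; first by move<-; rewrite subrK.
by move->; rewrite addrK.
Qed.

End CenteredVariable.

(** * Deviation on both sides *)
Section TrimmingRanks.
Context (R : realType) (N k : nat) (y : 'I_N -> R).
Hypothesis k_gt0 : (0 < k)%N.
Hypothesis k_lt : (k < N)%N.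
Implicit Type s : R.

Let alpha := order_stat y k.
Let beta := order_stat y (N - k).

Let sum_predC (A B : 'I_N -> bool) : (forall i, A i = ~~ B i) ->
  (\sum_i A i + \sum_i B i = N)%N.
Proof.
move=> AB; rewrite -big_split /= (eq_bigr (fun=> 1%N)).
  by rewrite sum1_card card_ord.
by move=> i _; rewrite AB; case: (B i).
Qed.

(** Reflection turns the rank k into N + 1 - k, whereas the upper truncation point
    has rank N - k; the strict inequalities in the next four lemmas absorb this
    shift by one. *)
Lemma trimming_lower_le s : k%:R < \sum_i (y i <= s)%R%:R :> R -> alpha <= s.
Proof.
by rewrite -natr_sum ltr_nat => ks; apply: order_stat_le => //; exact: ltnW.
Qed.

Lemma trimming_upper_le s : \sum_i (s < y i)%R%:R < k%:R :> R -> beta <= s.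
Proof.
rewrite -natr_sum ltr_nat => ks; apply: order_stat_le; first by rewrite subn_gt0.
have := @sum_predC (fun i => y i <= s) (fun i => s < y i) (fun i => leNgt _ _).
lia.
Qed.

Lemma trimming_upper_ge s : k%:R < \sum_i (s <= y i)%R%:R :> R -> s <= beta.
Proof.
rewrite -natr_sum ltr_nat => ks; apply: order_stat_ge.
  by rewrite subn_gt0 k_lt leq_subr.
have := @sum_predC (fun i => y i < s) (fun i => s <= y i) (fun i => ltNge _ _).
lia.
Qed.

Lemma trimming_lower_ge s : \sum_i (y i < s)%R%:R < k%:R :> R -> s <= alpha.
Proof.
rewrite -natr_sum ltr_nat => ks; apply: order_stat_ge => //.
by rewrite k_gt0 ltnW.
Qed.

End TrimmingRanks.

Section TwoSided.
Context (R : realType).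
Context (d0 : measure_display) (T0 : measurableType d0) (P0 : probability T0 R).
Context (X0 : {RV P0 >-> R}).
Hypothesis X0_ac : absolutely_continuous X0.
Hypothesis X0_mean : P0.-integrable setT (EFin \o X0).
Hypothesis X0_var : ('V_P0[X0] < +oo)%E.
Context (d : measure_display) (T : measurableType d) (P : probability T R).
Context (N : nat) (N_gt0 : (0 < N)%N).
Context (X Y : 'I_N -> {RV P >-> R}).
Hypothesis XY_copies : forall k, identically_distributed (joint_sample X Y k) X0.
Hypothesis XY_indep : mutually_independent (joint_sample X Y).
Context (eta : R) (eta_ge0 : 0 <= eta).
Context (Xt Yt : 'I_N -> {RV P >-> R}).
Hypothesis corruption : forall w : T,
    #|[set k : 'I_N + 'I_N |
        joint_sample Xt Yt k w != joint_sample X Y k w]%SET|%:R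
      <= 2 * eta * N%:R.
Context (eps L : R).
Hypothesis eps_gt0 : 0 < eps.
Hypothesis eps_lt : eps < 1 / 2.
Hypothesis epsN_nat : eps * N%:R \is a Num.nat.
Hypothesis L_ge0 : 0 <= L.
Hypothesis expL : expR (- L) <= 1 / 4.
Hypothesis epsNE : eps * N%:R = 8 * eta * N%:R + 12 * L.

Let mu := mean P0 X0.
Let sigma := stddev P0 X0.
Let muhat w := trimmed_mean eps (fun i => Xt i w) (fun i => Yt i w).
Let hp (x : R) := x - mu.
Let hm (x : R) := - (x - mu).
Let p := 2 * eps - 4 / 5 * eps ^+ 2.
Let theta := eps / 4.
Let k := Num.truncn (eps * N%:R).

Let kE : k%:R = eps * N%:R. Proof. exact: truncnK. Qed.

Let k_gt0 : (0 < k)%N.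
Proof. by rewrite -(ltr_nat R) kE mulr_gt0// ltr0n. Qed.

Let k_half : (k.*2 < N)%N.
Proof.
rewrite -(ltr_nat R) -addnn natrD kE.
have N0 : 0 < N%:R :> R by rewrite ltr0n.
have : eps * N%:R < 1 / 2 * N%:R by rewrite ltr_pM2r.
by lra.
Qed.

Let k_lt : (k < N)%N.
Proof. by apply: leq_ltn_trans k_half; rewrite -addnn leq_addr. Qed.

Let k_le : (k <= N - k)%N.
Proof. by rewrite leq_subRL ?addnn; exact: ltnW. Qed.

Let truncn_compl : Num.truncn ((1 - eps) * N%:R) = (N - k)%N.
Proof. by rewrite mulrBl mul1r -kE -natrB ?natrK// ltnW. Qed.

Let mhp : measurable_fun setT hp.
Proof. exact: measurable_funB. Qed.

Let mhm : measurable_fun setT hm.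
Proof. exact: measurableT_comp. Qed.

Let Z := centered P0 X0.
Let iZ := integrable_centered X0_mean.
Let mZ := measurable_centered X0_mean.

Let sigma_ge0 : 0 <= sigma. Proof. exact: sqrtr_ge0. Qed.

Let joint_card (h : R -> R) w :
  #|[set i | joint_sample (fun i => h (Xt i w)) (fun i => h (Yt i w)) i !=
     joint_sample (fun i => h (X i w)) (fun i => h (Y i w)) i]%SET|%:R
        <= 2 * eta * N%:R.
Proof.
apply: le_trans (corruption w); rewrite ler_nat subset_leq_card//.
by apply/fintype.subsetP => -[i|i]; rewrite !inE /=; apply: contraNneq => ->.
Qed.

Let iZ2 := integrable_centered_sqr X0_mean X0_var.
Let Z2 := second_moment_centered X0.
Let Z0 := mean_centered X0_mean.
Let at0 := atomless_centered X0_ac.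

Let iZN : P0.-integrable [set: T0] (EFin \o (fun w => hm (X0 w))).
Proof.
have := integrableZ_EFin (-1) iZ.
by apply: eq_integrable => // w _ /=; rewrite /hm mulN1r.
Qed.

Let ZN0 : \int[P0]_w hm (X0 w) = 0.
Proof.
under eq_Rintegral do rewrite /hm -mulN1r.
by rewrite RintegralZl// Z0 mulr0.
Qed.

Let iZN2 : P0.-integrable [set: T0] (EFin \o (fun w => hm (X0 w) ^+ 2)).
Proof. by apply: eq_integrable iZ2 => // w _ /=; rewrite /hm sqrrN. Qed.

Let ZN2 : \int[P0]_w (hm (X0 w) ^+ 2) = sigma ^+ 2.
Proof. by rewrite -Z2; apply: eq_Rintegral => w _; rewrite /hm sqrrN. Qed.

Let atN0 x : P0 [set w | hm (X0 w) = x] = 0.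
Proof.
rewrite -(at0 (- x)); congr (P0 _).
apply/seteqP; split => w; rewrite /hm /centered /=; first by move<-; rewrite opprK.
by move->; rewrite opprK.
Qed.

Lemma measurable_muhat : measurable_fun setT muhat.
Proof.
apply: measurable_trimmed_mean => //; rewrite ?truncn_compl.
- by rewrite -/k k_gt0 ltnW.
- by rewrite subn_gt0 k_lt leq_subr.
Qed.

Lemma two_sided_bound tau bound : 0 < tau -> 12 * tau ^+ 2 <= eps ->
    (forall a b, P0 [set w | hp (X0 w) <= a] = p%:E ->
       P0 [set w | b < hp (X0 w)] = theta%:E ->
       deviation_radius X0 hp eps eta sigma a b tau <= bound) ->
    (forall a b, P0 [set w | hm (X0 w) <= a] = p%:E ->
       P0 [set w | b < hm (X0 w)] = theta%:E ->
       deviation_radius X0 hm eps eta sigma a b tau <= bound) ->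
  ((1 - 4 * expR (- (N%:R * tau ^+ 2)))%:E <=
     P [set w | (`|muhat w - mu| <= bound)%R])%E.
Proof.
move=> tau0 tau_eps Bp Bm.
have [Gp [mGp PGp HGp]] := one_sided_bound N_gt0 XY_copies XY_indep mhp eps_gt0
  eps_lt L_ge0 expL epsNE iZ Z0 iZ2 Z2 sigma_ge0 at0 tau0 tau_eps Bp.
have [Gm [mGm PGm HGm]] := one_sided_bound N_gt0 XY_copies XY_indep mhm eps_gt0
  eps_lt L_ge0 expL epsNE iZN ZN0 iZN2 ZN2 sigma_ge0 atN0 tau0 tau_eps Bm.
have N0 : N%:R != 0 :> R by rewrite pnatr_eq0 -lt0n.
have sub : Gp `&` Gm `<=` [set w | `|muhat w - mu| <= bound].
  move=> w [/HGp {}HGp /HGm {}HGm] /=.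
  pose alpha := order_stat (fun i => Yt i w) k.
  pose beta := order_stat (fun i => Yt i w) (N - k).
  have ab : alpha <= beta.
    by apply: order_stat_homo k_gt0 _; rewrite leq_subr andbT.
  have muhatE : muhat w = N%:R^-1 * \sum_i phi alpha beta (Xt i w).
    by rewrite /muhat /trimmed_mean truncn_compl.
  have up : muhat w - mu <= bound.
    have := HGp (fun i => hp (Xt i w)) (fun i => hp (Yt i w)) (alpha - mu) (beta - mu).
    rewrite lerD2r => /(_ ab (joint_card hp w)); rewrite -kE.
    under eq_bigr do rewrite phi_shift.
    rewrite sumrB sumr_const card_ord -[mu *+ N]mulr_natl mulrBr mulKf// muhatE.
    apply => t.
      under eq_bigr do rewrite /hp lerBlDr.
      by move=> /(trimming_lower_le k_gt0); rewrite lerBlDr.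
    under eq_bigr do rewrite /hp ltrBrDr.
    by move=> /(trimming_upper_le k_gt0 k_lt); rewrite lerBlDr.
  have down : - (muhat w - mu) <= bound.
    have := HGm (fun i => hm (Xt i w)) (fun i => hm (Yt i w))
      (- (beta - mu)) (- (alpha - mu)).
    rewrite lerN2 lerD2r => /(_ ab (joint_card hm w)); rewrite -kE.
    have abmu : alpha - mu <= beta - mu by rewrite lerD2r.
    under eq_bigr do rewrite phi_opp// phi_shift.
    rewrite sumrN sumrB sumr_const card_ord -[mu *+ N]mulr_natl mulrN mulrBr mulKf//.
    rewrite muhatE.
    apply => t.
      under eq_bigr do rewrite /hm lerNl lerBrDr.
      by move=> /(trimming_upper_ge k_gt0 k_lt); rewrite lerNl lerBrDr.
    under eq_bigr do rewrite /hm ltrNr ltrBlDr.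
    by move=> /(trimming_lower_ge k_gt0 k_lt); rewrite lerNl lerBrDr.
  by rewrite ler_norml up andbT lerNl.
have mtarget : measurable [set w | `|muhat w - mu| <= bound].
  apply: measurable_leset; apply: measurableT_comp => //.
  by apply: measurable_funB => //; exact: measurable_muhat.
have mG := measurableI _ _ mGp mGm.
apply: (@le_trans _ _ (P (Gp `&` Gm))); last by apply: le_measure; rewrite ?inE.
have PC : (P (~` (Gp `&` Gm)) <= (4 * expR (- (N%:R * tau ^+ 2)))%:E)%E.
  rewrite setCI; apply: (le_trans (measureU2 P (measurableC mGp) (measurableC mGm))).
  apply: (le_trans (leeD PGp PGm)); rewrite -EFinD lee_fin.
  by have := expR_ge0 (- (N%:R * tau ^+ 2)); lra.
rewrite -[Gp `&` Gm]setCK probability_setC; last exact: measurableC.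
move: PC; rewrite -(fineK (fin_num_measure P _ (measurableC mG))).
by rewrite -EFinB !lee_fin; lra.
Qed.

Let lo := quantile P0 Z (4 * eps / 2).
Let hi := quantile P0 Z (1 - 4 * eps / 2).
Let lo_tail := \int[P0]_w (`|Z w| * \1_[set w | Z w <= lo] w).
Let hi_tail := \int[P0]_w (`|Z w| * \1_[set w | hi <= Z w] w).
Let E := Num.max lo_tail hi_tail.

Let tail_meanE : tail_mean P0 (4 * eps) X0 = E%:E.
Proof.
have EE A : measurable A ->
    ('E_P0[fun w => (`|Z w| * \1_A w)%R] = (\int[P0]_w (`|Z w| * \1_A w))%:E)%E.
  move=> mA; rewrite expectation.unlock /Rintegral fineK//.
  apply: integrable_fin_num => //.
  by apply: integrable_mul_indic => //; exact: integrable_normr.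
rewrite /tail_mean -/Z EE; last exact: measurable_leset.
by rewrite EE; [rewrite EFin_max|exact: measurable_geset].
Qed.

Let Qlo : P0 [set w | Z w <= lo] = (2 * eps)%:E.
Proof.
have p0 : 0 < 4 * eps / 2 by have := eps_gt0; lra.
have p1 : 4 * eps / 2 < 1 by have := eps_lt; lra.
by have [-> _] := quantile_level mZ at0 p0 p1; congr EFin; field.
Qed.

Let Qhi : P0 [set w | hi <= Z w] = (2 * eps)%:E.
Proof.
have p0 : 0 < 1 - 4 * eps / 2 by have := eps_lt; lra.
have p1 : 1 - 4 * eps / 2 < 1 by have := eps_gt0; lra.
by have [_ ->] := quantile_level mZ at0 p0 p1; congr EFin; field.
Qed.

Let lo_tail_le : lo_tail <= E. Proof. by rewrite le_max lexx. Qed.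
Let hi_tail_le : hi_tail <= E. Proof. by rewrite le_max lexx orbT. Qed.

Lemma trimmed_mean_tail_bound tau : 0 < tau -> 12 * tau ^+ 2 = eps - 8 * eta ->
  ((1 - 4 * expR (- (N%:R * tau ^+ 2)))%:E <=
     P [set w | ((`|muhat w - mu|%R)%:E <=
       3%:E * tail_mean P0 (4 * eps) X0 + (2 * sigma * tau)%:E)%E])%E.
Proof.
move=> tau0 tauE; rewrite tail_meanE.
have tau_eps : 12 * tau ^+ 2 <= eps by have := eta_ge0; lra.
apply: (@two_sided_bound tau (3 * E + 2 * sigma * tau)) => // a b Qa Qb.
  exact: (deviation_tail_bound mhp sigma eps_gt0 eps_lt eta_ge0 iZ Z0 Qa Qb
    (ltW tau0) tauE Qlo Qhi lo_tail_le hi_tail_le).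
(* For the reflected variable the two tails are exchanged. *)
have Z_hm w : (hm (X0 w) <= - hi) = (hi <= Z w) by rewrite /hm lerN2.
have hm_Z w : (- lo <= hm (X0 w)) = (Z w <= lo) by rewrite /hm lerN2.
apply: (@deviation_tail_bound _ _ _ _ _ _ mhm eps eta sigma eps_gt0 eps_lt eta_ge0
    iZN ZN0 a b Qa Qb tau (- hi) (- lo)) => //; first exact: ltW.
- by under eq_set do rewrite Z_hm; exact: Qhi.
- by under eq_set do rewrite hm_Z; exact: Qlo.
- apply: le_trans hi_tail_le; rewrite le_eqVlt; apply/orP; left; apply/eqP.
  by apply: eq_Rintegral => w _; rewrite !indic_boolE Z_hm normrN.
- apply: le_trans lo_tail_le; rewrite le_eqVlt; apply/orP; left; apply/eqP.
  by apply: eq_Rintegral => w _; rewrite !indic_boolE hm_Z normrN.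
Qed.

Lemma trimmed_mean_stddev_bound tau : 0 < tau -> 12 * tau ^+ 2 = eps ->
  ((1 - 4 * expR (- (N%:R * tau ^+ 2)))%:E <=
     P [set w | (`|muhat w - mu| <= 10 * Num.sqrt eps * sigma)%R])%E.
Proof.
move=> tau0 tauE.
have eta_eps : 8 * eta <= eps.
  rewrite -(ler_pM2r (_ : 0 < N%:R :> R)) ?ltr0n// epsNE.
  by have := L_ge0; lra.
apply: two_sided_bound => [||a b Qa Qb|a b Qa Qb] //; first by rewrite tauE.
- exact: (deviation_stddev_bound mhp eps_gt0 eps_lt eta_ge0 iZ Z0 iZ2 Z2 sigma_ge0
    Qa Qb eta_eps (ltW tau0) tauE).
- exact: (deviation_stddev_bound mhm eps_gt0 eps_lt eta_ge0 iZN ZN0 iZN2 ZN2 sigma_ge0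
    Qa Qb eta_eps (ltW tau0) tauE).
Qed.

End TwoSided.

(** * Performance of the trimmed mean *)
Theorem theorem1 (R : realType)
  (d0 : measure_display) (T0 : measurableType d0) (P0 : probability T0 R)
  (X0 : {RV P0 >-> R})
  (X0_ac : absolutely_continuous X0)
  (X0_mean : P0.-integrable setT (EFin \o X0))
  (X0_var : ('V_P0[X0] < +oo)%E)
  (d : measure_display) (T : measurableType d) (P : probability T R)
  (N : nat) (N_gt0 : (0 < N)%N)
  (X Y : 'I_N -> {RV P >-> R})
  (XY_copies : forall k : 'I_N + 'I_N,
    identically_distributed (joint_sample X Y k) X0)
  (XY_indep : mutually_independent (joint_sample X Y))
  (eta : R) (eta_ge0 : 0 <= eta) (eta_lt1 : eta < 1)
  (Xt Yt : 'I_N -> {RV P >-> R})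
  (corruption : forall w : T,
    #|[set k : 'I_N + 'I_N |
        joint_sample Xt Yt k w != joint_sample X Y k w]%SET|%:R
      <= 2 * eta * N%:R)
  (delta : R) (delta_gt0 : 0 < delta) (delta_lt1 : delta < 1)
  (delta_ge : expR (- N%:R) / 4 <= delta)
  (eps : R) (epsE : eps = 8 * eta + 12 * (ln (4 / delta) / N%:R))
  (eps_lt : eps < 1 / 2) (epsN_nat : eps * N%:R \is a Num.nat) :
  let muhat w := trimmed_mean eps (fun i => Xt i w) (fun i => Yt i w) in
  let mu := mean P0 X0 in
  let sigma := stddev P0 X0 in
  ((1 - delta)%:E <=
     P [set w | ((`|muhat w - mu|%R)%:E <=
       3%:E * tail_mean P0 (4 * eps) X0
       + (2 * sigma * Num.sqrt (ln (4 / delta) / N%:R))%:E)%E])%E /\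
  ((1 - 4 * expR (- (eps * N%:R / 12)))%:E <=
     P [set w | (`|muhat w - mu| <= 10 * Num.sqrt eps * sigma)%R])%E.
Proof.
move=> muhat mu sigma.
pose L := ln (4 / delta).
have N0 : 0 < N%:R :> R by rewrite ltr0n.
have four_gt0 : 0 < 4 / delta by rewrite divr_gt0.
have expNL : expR (- L) = delta / 4.
  by rewrite expRN /L lnK ?posrE// invf_div.
have expL : expR (- L) <= 1 / 4 by rewrite expNL ler_wpM2r// ltW.
have L_gt0 : 0 < L.
  by rewrite -(oppr_lt0 L) -expR_lt1 expNL; lra.
have LN : 12 * (L / N%:R) = eps - 8 * eta by rewrite epsE -/L; ring.
have LN0 : 0 < L / N%:R by rewrite divr_gt0.
have eps_gt0 : 0 < eps by lra.
have epsNE : eps * N%:R = 8 * eta * N%:R + 12 * L.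
  by rewrite epsE -/L; field; rewrite gt_eqF.
split.
- pose tau := Num.sqrt (L / N%:R).
  have tau0 : 0 < tau by rewrite sqrtr_gt0.
  have tau2 : tau ^+ 2 = L / N%:R by rewrite sqr_sqrtr// ltW.
  have -> : (1 - delta = 1 - 4 * expR (- (N%:R * tau ^+ 2)))%R.
    have -> : N%:R * tau ^+ 2 = L by rewrite tau2; field; rewrite gt_eqF.
    by rewrite expNL; field.
  apply: (trimmed_mean_tail_bound X0_ac X0_mean X0_var N_gt0 XY_copies XY_indep
    eta_ge0 corruption eps_gt0 eps_lt epsN_nat (ltW L_gt0) expL epsNE tau0).
  by rewrite tau2.
- pose tau := Num.sqrt (eps / 12).
  have tau0 : 0 < tau by rewrite sqrtr_gt0 divr_gt0.
  have tau2 : tau ^+ 2 = eps / 12 by rewrite sqr_sqrtr// divr_ge0// ltW.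
  have -> : (eps * N%:R / 12 = N%:R * tau ^+ 2)%R by rewrite tau2; ring.
  apply: (trimmed_mean_stddev_bound X0_ac X0_mean X0_var N_gt0 XY_copies XY_indep
    eta_ge0 corruption eps_gt0 eps_lt epsN_nat (ltW L_gt0) expL epsNE tau0).
  by rewrite tau2; field.
Qed.
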